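(* Let $A$ be a linear Nakayama algebra with vertices labelled $1,\dots,n$ so that the arrows are $i\to i+1$. Then $A$ is Auslander regular if and only if the Coxeter matrix $C_A$ has a Bruhat decomposition $C_A=U_1PU_2$ in which $U_1$ is the identity matrix.
   Context: A linear Nakayama algebra is $A=KQ/I$ with $K$ a field, $Q$ the quiver $1\to2\to\cdots\to n$ and $I$ admissible. Modules are finitely generated right modules. Let $0\to A\to I^0\to I^1\to\cdots$ be a minimal injective coresolution of $A_A$; $A$ is Auslander–Gorenstein if $\operatorname{id}A_A<\infty$ and $\operatorname{pd}I^i\le i$ for all $i\ge 0$, and Auslander regular if moreover $A$ has finite global dimension. The Cartan matrix $\phi_A$ has entries $\phi_{i,j}=\dim_K e_jAe_i$ and the Coxeter matrix is $C_A=-\phi_A^T\phi_A^{-1}$. A Bruhat decomposition is a factorisation $C_A=U_1PU_2$ with $U_1,U_2$ invertible upper triangular matrices and $P$ a permutation matrix. *)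

(* Defs.v *)
From mathcomp Require Import all_boot all_order all_algebra all_fingroup.
Set Implicit Arguments. Unset Strict Implicit. Unset Printing Implicit Defensive.
Import GRing.Theory.
Local Open Scope ring_scope.

(* Conventions.  Vertices 1,...,n of the paper are the naturals 0,...,n-1    *)
(* here; the arrows are k -> k+1.  Paths are composed as in                  *)
(* Assem-Simson-Skowronski (the path from i to j is alpha_i ... alpha_(j-1)),*)
(* so e_i A is spanned by the paths starting at i and right A-modules are    *)
(* representations of the bound quiver (Q, I) (M |-> (M e_k, x |-> x alpha)).*)
(* Admissible ideals.  For the linear quiver every space e_i KQ e_j is at    *)
(* most one-dimensional, so every two-sided ideal I of KQ is spanned by the  *)
(* paths it contains.  We therefore encode I by the boolean relation         *)
(* S i j  <->  the path from i to j lies in I.                               *)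

Definition admissible_ideal (n : nat) (S : nat -> nat -> bool) : Prop :=
  (* I is contained in the square of the arrow ideal (no idempotents/arrows) *)
  (forall i j, S i j -> (i.+1 < j)%N) /\
  (* only genuine paths of Q are recorded *)
  (forall i j, S i j -> (j < n)%N) /\
  (* I is a two-sided ideal: closed under left/right multiplication by paths *)
  (forall i j i' j', S i j -> (i' <= i)%N -> (j <= j')%N -> (j' < n)%N -> S i' j').
(* (R^m \subseteq I holds automatically since Q is finite and acyclic.) *)

Section Reps.
Variable K : fieldType.

(* A finite-dimensional representation of the linear quiver: spaces        *)
(* V_k = K^(rdim k) (row vectors), and maps V_k -> V_(k+1) acting on the     *)
(* right.                                                                   *)
Record rep := Rep {
  rdim : nat -> nat;
  rmap : forall k, 'M[K]_(rdim k, rdim k.+1)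
}.

Fixpoint pcomp (M : rep) (i l : nat) : 'M[K]_(rdim M i, rdim M (l + i)) :=
  match l with
  | 0 => 1%:M
  | l'.+1 => pcomp M i l' *m rmap M (l' + i)
  end.

Variables (n : nat) (S : nat -> nat -> bool).

(* right A-modules, A = KQ/I, as representations of the bound quiver *)
Definition is_rep (M : rep) : Prop :=
  (forall k, (n <= k)%N -> rdim M k = 0) /\
  (forall i l, S i (l + i) -> pcomp M i l = 0).

Definition homf (M N : rep) := forall k, 'M[K]_(rdim M k, rdim N k).

Definition is_hom (M N : rep) (f : homf M N) : Prop :=
  forall k, rmap M k *m f k.+1 = f k *m rmap N k.

Definition epi (M N : rep) (f : homf M N) : Prop := forall k, row_full (f k).
Definition mono (M N : rep) (f : homf M N) : Prop := forall k, row_free (f k).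

Definition exact_at (L M N : rep) (f : homf L M) (g : homf M N) : Prop :=
  forall k, (f k == kermx (g k))%MS.

Definition is_zero_rep (M : rep) : Prop := forall k, rdim M k = 0.

Definition projective (P : rep) : Prop :=
  is_rep P /\
  forall (M N : rep) (e : homf M N) (h : homf P N),
    is_rep M -> is_rep N -> is_hom e -> epi e -> is_hom h ->
    exists h' : homf P M, is_hom h' /\ forall k, h' k *m e k = h k.

Definition injective (J : rep) : Prop :=
  is_rep J /\
  forall (M N : rep) (m : homf M N) (h : homf M J),
    is_rep M -> is_rep N -> is_hom m -> mono m -> is_hom h ->
    exists h' : homf N J, is_hom h' /\ forall k, m k *m h' k = h k.

Definition pd_le (M : rep) (m : nat) : Prop :=
  exists (P : nat -> rep) (d : forall j, homf (P j.+1) (P j)) (eps : homf (P 0) M),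
    (forall j, projective (P j)) /\ (forall j, (m < j)%N -> is_zero_rep (P j)) /\
    (forall j, is_hom (d j)) /\ is_hom eps /\ epi eps /\
    exact_at (d 0) eps /\ (forall j, exact_at (d j.+1) (d j)).

Definition is_subrep (J : rep) (U : forall k, 'M[K]_(rdim J k)) : Prop :=
  forall k, (U k *m rmap J k <= U k.+1)%MS.

Definition essential_image (M J : rep) (f : homf M J) : Prop :=
  forall U : forall k, 'M[K]_(rdim J k), is_subrep U ->
    (exists k, \rank (U k) != 0) -> exists k, \rank (U k :&: f k)%MS != 0.

(* The regular module A_A.  A e_k has as basis the nonzero paths ending at  *)
(* k, i.e. the paths from i to k with aS k <= i <= k, where aS k is the     *)
(* number of paths ending at k that lie in I (these start at 0..aS k - 1).  *)
(* Basis vector j of A e_k is the path from aS k + j to k; right            *)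
(* multiplication by the arrow k -> k+1 sends it to the path from aS k + j  *)
(* to k+1 (basis vector aS k + j - aS (k+1) of A e_(k+1)) or to 0 if that   *)
(* path lies in I.                                                          *)
Definition aS (k : nat) : nat := (\sum_(i < k) S i k)%N.

Definition regdim (k : nat) : nat := if (k < n)%N then (k.+1 - aS k)%N else 0%N.

Definition regular_rep : rep :=
  @Rep regdim (fun k => \matrix_(j < regdim k, j' < regdim k.+1)
                          ((aS k + j == aS k.+1 + j')%N)%:R).

Definition min_inj_coresolution (J : nat -> rep) (iota : homf regular_rep (J 0))
    (dl : forall j, homf (J j) (J j.+1)) : Prop :=
  (forall j, injective (J j)) /\ is_hom iota /\ (forall j, is_hom (dl j)) /\
  mono iota /\ exact_at iota (dl 0) /\ (forall j, exact_at (dl j) (dl j.+1)) /\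
  essential_image iota /\ (forall j, essential_image (dl j)).

Definition AuslanderGorenstein : Prop :=
  exists (J : nat -> rep) (iota : homf regular_rep (J 0))
         (dl : forall j, homf (J j) (J j.+1)),
    min_inj_coresolution iota dl /\
    (* id A_A < oo *)
    (exists m, is_zero_rep (J m)) /\
    (forall i, pd_le (J i) i).

Definition finite_gldim : Prop :=
  exists m, forall M : rep, is_rep M -> pd_le M m.

Definition AuslanderRegular : Prop := AuslanderGorenstein /\ finite_gldim.

End Reps.

(* Cartan matrix: phi_(i,j) = dim e_j A e_i = 1 iff the path j -> i is       *)
(* nonzero in A (0-indexed entries).                                         *)
Definition cartan (n : nat) (S : nat -> nat -> bool) : 'M[rat]_n :=
  \matrix_(i < n, j < n) ((j <= i)%N && ~~ S j i)%:R.

Definition coxeter (n : nat) (S : nat -> nat -> bool) : 'M[rat]_n :=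
  - ((cartan n S)^T *m invmx (cartan n S)).

Definition upper_triangular (n : nat) (U : 'M[rat]_n) : Prop :=
  forall i j : 'I_n, (j < i)%N -> U i j = 0.

Definition bruhat_decomposition (n : nat) (C U1 P U2 : 'M[rat]_n) : Prop :=
  [/\ upper_triangular U1 /\ U1 \in unitmx, is_perm_mx P,
      upper_triangular U2 /\ U2 \in unitmx & C = U1 *m P *m U2].

(* Main.v *)
Require Import Defs.
From mathcomp Require Import all_boot all_order all_algebra all_fingroup.
From mathcomp Require Import zify.
Set Implicit Arguments. Unset Strict Implicit. Unset Printing Implicit Defensive.

(* Label the n + 1 gaps around the vertices, so that an indecomposable module is
   an interval [x, y), the projectives are [x, f x), the injectives [g y, y), and
   f, g form a Galois connection.  The minimal injective coresolution of [a, f a)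
   has terms [b_(k+2), b_k) with b_0 = f a, b_1 = a, b_(k+2) = g b_k, until it stops.
   Row a of the Coxeter matrix is minus the alternating sum of the indicators of the
   b_k, so its leading entry sits at the last term psi(a), and the Coxeter matrix is
   P U exactly when psi is injective.  If the Auslander condition holds below
   degree k then applying f^(k/2) recovers a from the k-th cosyzygy; for k the
   length of the coresolution this inverts psi.  Conversely, if psi is onto, the Auslander
   condition in degree k follows by induction on k: for even k it is automatic,
   and for odd k a failure at b_k is incompatible with b_k lying in the image of psi.
   An arbitrary injective coresolution J of A satisfies pd J_k >= pd [b_(k+2), b_k)
   because the socle class of the latter survives in J_k, tested by functionals. *)

(** * Intervals and Galois connections *)

Section Combinatorics.
Variables (n : nat) (f g : nat -> nat).
Hypothesis gal : forall b x, b <= n -> (g b <= x) = (b <= f x).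
Hypothesis f_le_n : forall x, f x <= n.
Hypothesis lt_f : forall x, x < n -> x < f x.

Lemma f_mono x y : x <= y -> f x <= f y.
Proof.
move=> xy; have h : g (f x) <= x by rewrite gal.
by rewrite -gal // (leq_trans h xy).
Qed.

Lemma g_mono b c : b <= c -> c <= n -> g b <= g c.
Proof.
move=> bc cn; have h : c <= f (g c) by rewrite -gal.
by rewrite gal ?(leq_trans bc cn) // (leq_trans bc h).
Qed.

Lemma leq_fg b : b <= n -> b <= f (g b).
Proof. by move=> bn; rewrite -gal. Qed.

Lemma lt_g b : 0 < b -> b <= n -> g b < b.
Proof. by case: b => // b _ bn; rewrite ltnS gal // lt_f. Qed.

Lemma g_le b : b <= n -> g b <= b.
Proof. by case: b => [_|b bn]; [rewrite gal | apply/ltnW/lt_g]. Qed.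

Lemma le_f x : x <= n -> x <= f x.
Proof. by move=> xn; rewrite -gal // g_le. Qed.

Lemma iter_f_mono t x y : x <= y -> iter t f x <= iter t f y.
Proof. by elim: t => //= t IH /IH/f_mono. Qed.

Lemma iter_g_le_n t b : b <= n -> iter t g b <= n.
Proof. by elim: t => //= t IH /IH bn; apply: leq_trans (g_le bn) bn. Qed.

Lemma iter_gal t b x : b <= n -> (iter t g b <= x) = (b <= iter t f x).
Proof.
elim: t x => //= t IH x bn.
by rewrite gal ?iter_g_le_n // IH // -iterSr.
Qed.

(* [pdi k x y] says that the interval module [x, y) has projective dimension at
   most k: its projective cover is [x, f x) and its syzygy is [y, f x). *)
Fixpoint pdi (k x y : nat) : bool :=
  (y <= x) || (if k is k'.+1 then pdi k' y (f x) else f x <= y).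

(** The 2t-th syzygy of [x, y) is [f^t x, f^t y) and the next one is [f^t y, f^(t+1) x). In the
    first case an odd syzygy vanishes in time, in the second an even one. *)
Lemma pdi_cases k x y : pdi k x y ->
  (exists2 t, t.*2 <= k & iter t.+1 f x <= iter t f y) \/
  (exists2 t, t.*2 <= k.+1 & iter t f y <= iter t f x).
Proof.
elim: k x y => [|k IH] x y /= /orP[yx|]; try by right; exists 0.
  by left; exists 0.
case/IH=> [[t tk ft]|[t tk ft]].
  by right; exists t.+1; rewrite ?doubleS // (iterSr t f x).
by left; exists t => //; rewrite -iterS (iterSr t f x).
Qed.

Lemma pdi_even k t x y : t.*2 <= k -> iter t.+1 f x <= iter t f y -> pdi k x y.
Proof.
elim: t k x y => [|t IH] k x y.
  by case: k => [|[|k]] /= _ ->; rewrite ?orbT.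
case: k => [|[|k]]; rewrite ?doubleS // !ltnS => tk h.
have := IH k (f x) (f y) tk; rewrite -!iterSr => /(_ h) /= ->.
by rewrite !orbT.
Qed.

Lemma pdi_odd k t x y : t.*2 <= k.+1 -> iter t f y <= iter t f x -> pdi k x y.
Proof.
case: t => [|t] tk.
  by case: k {tk} => [|k] /= ->.
case: k tk => [|k]; rewrite doubleS ?ltnS // => tk h.
by apply/orP; right; apply: (@pdi_even k t) tk _; rewrite -[iter t f (f x)]iterSr.
Qed.

Lemma pdi_leq k l x y : k <= l -> pdi k x y -> pdi l x y.
Proof.
move=> kl /pdi_cases[[t tk]|[t tk]]; [apply: pdi_even | apply: pdi_odd];
  exact: leq_trans tk _.
Qed.

Fixpoint cosyz (a k : nat) : nat * nat :=
  if k is k'.+1 then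
    let: (y, x) := cosyz a k' in (x, if x < y then g y else x)
  else (f a, a).

(* The k-th cosyzygy of the projective [a, f a) is [b_(k+1), b_k), the k-th term
   of its minimal injective coresolution is [b_(k+2), b_k), where
   b_k = [bpt a k]; the sequence is constant once a cosyzygy vanishes. *)
Definition bpt (a k : nat) : nat := (cosyz a k).1.

Lemma cosyzE a k : cosyz a k = (bpt a k, bpt a k.+1).
Proof. by rewrite /bpt /=; case: (cosyz a k). Qed.

Lemma bptSS a k :
  bpt a k.+2 = if bpt a k.+1 < bpt a k then g (bpt a k) else bpt a k.+1.
Proof. by rewrite {1}/bpt /= cosyzE. Qed.

Lemma bpt_strict_pred a k : bpt a k.+2 < bpt a k.+1 -> bpt a k.+1 < bpt a k.
Proof. by rewrite bptSS; case: ifP => //; rewrite ltnn. Qed.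

(** The first inequality embeds the cosyzygy [b_(k+1), b_k) in the injective [g b_k, b_k). The three
    bounds feed one another in the induction. *)
Lemma bpt_inv a k : a <= n ->
  [/\ g (bpt a k) <= bpt a k.+1, bpt a k.+1 <= bpt a k & bpt a k <= n].
Proof.
move=> an; elim: k => [|k [h1 h2 h3]].
  by rewrite /bpt /= gal // leqnn le_f.
have bn : bpt a k.+1 <= n by exact: leq_trans h2 h3.
by rewrite bptSS; case: ifP => _; split; rewrite ?g_mono ?g_le.
Qed.

Lemma bpt_le_n a k : a <= n -> bpt a k <= n.
Proof. by move=> an; case: (bpt_inv k an). Qed.

Lemma bptS_le a k : a <= n -> bpt a k.+1 <= bpt a k.
Proof. by move=> an; case: (bpt_inv k an). Qed.

Lemma g_bpt_le a k : a <= n -> g (bpt a k) <= bpt a k.+1.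
Proof. by move=> an; case: (bpt_inv k an). Qed.

Lemma bpt_strict_le a k i : i <= k -> bpt a k.+1 < bpt a k -> bpt a i.+1 < bpt a i.
Proof.
elim: k => [|k IH]; first by rewrite leqn0 => /eqP->.
by rewrite leq_eqVlt => /orP[/eqP-> //|ik /bpt_strict_pred]; apply: IH.
Qed.

Lemma bpt_iter_g a k t m :
  bpt a k.+1 < bpt a k -> m + t.*2 <= k.+2 -> bpt a (m + t.*2) = iter t g (bpt a m).
Proof.
move=> sk; elim: t => [|t IH]; first by rewrite addn0.
rewrite doubleS !addnS => h.
have st : bpt a (m + t.*2).+1 < bpt a (m + t.*2).
  by apply: bpt_strict_le sk; move: h; rewrite !ltnS.
by rewrite bptSS st IH //; lia.
Qed.

Lemma bpt_iter_f_ge a k t m :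
  a <= n -> bpt a k.+1 < bpt a k -> m + t.*2 <= k.+2 ->
  bpt a m <= iter t f (bpt a (m + t.*2)).
Proof.
by move=> an sk h; rewrite -iter_gal ?bpt_le_n // (bpt_iter_g sk).
Qed.

Lemma bpt_iter_f_lt a k t m x :
  a <= n -> bpt a k.+1 < bpt a k -> m + t.*2 <= k.+2 ->
  x < bpt a (m + t.*2) -> iter t f x < bpt a m.
Proof.
by move=> an sk h; rewrite (bpt_iter_g sk) // !ltnNge iter_gal ?bpt_le_n.
Qed.

(* Along a coresolution satisfying the Auslander condition below degree k,
   the projective resolution of the k-th cosyzygy leads back to [a, f a). *)
Lemma bpt_iter_f a k : a < n -> bpt a k.+1 < bpt a k ->
  (forall i, i < k -> pdi i (g (bpt a i)) (bpt a i)) ->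
  forall m, m <= k.+1 -> iter m./2 f (bpt a m) = bpt a (odd m).
Proof.
move=> an; have an' := ltnW an.
elim: k => [|k IH] sk hk m; first by case: m => [|[|]].
have sk' := bpt_strict_pred sk.
have {}IH := IH sk' (fun i ik => hk i (ltnW ik)).
rewrite leq_eqVlt => /orP[/eqP->{m}|]; last exact: IH.
have eg : bpt a k.+2 = g (bpt a k) by rewrite bptSS sk'.
rewrite -[k.+2./2]/(k./2.+1) oddS oddS negbK.
case/pdi_cases: (hk k (ltnSn k)) => -[t tk ft].
  apply/eqP; rewrite eqn_leq; apply/andP; split.
    rewrite -IH //; have -> : k./2 = k./2 - t + t by lia.
    by rewrite -addnS !iterD eg iter_f_mono.
  rewrite -IH // iterSr iter_f_mono // eg leq_fg //; exact: bpt_le_n.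
have e : k.+1 = odd k.+1 + k.+1./2.*2 by rewrite odd_double_half.
(* An even syzygy cannot vanish: with u = [k.+1./2], f^u b_(k+2) < b_(odd (k+1)) = f^u b_(k+1) <=
   f^u b_k, whereas f^t b_k <= f^t b_(k+2) with t <= u gives the reverse. *)
suff : iter k.+1./2 f (bpt a k.+2) < iter k.+1./2 f (bpt a k).
  rewrite ltnNge; case/negP.
  have -> : k.+1./2 = k.+1./2 - t + t by lia.
  by rewrite !iterD eg iter_f_mono.
have lt : iter k.+1./2 f (bpt a k.+2) < bpt a (odd k.+1).
  by apply: (bpt_iter_f_lt an' sk'); rewrite -e.
apply: leq_trans lt _; rewrite -IH // iter_f_mono // bptS_le //.
Qed.

(** In other words, d is the injective dimension of [a, f a). *)
Definition last_term (a d : nat) : bool :=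
  (bpt a d.+1 < bpt a d) && (bpt a d.+1 <= bpt a d.+2).

Lemma last_g a d : a <= n -> last_term a d -> bpt a d.+1 = g (bpt a d).
Proof.
move=> an /andP[sd ld]; apply/eqP; rewrite eqn_leq g_bpt_le // andbT.
by move: ld; rewrite bptSS sd.
Qed.

(** The coresolution has the term [g b_k, b_k) in degree k as long as the k-th cosyzygy is nonzero;
    the premise restricts to these degrees. *)
Definition auslander_at (a k : nat) : Prop :=
  bpt a k.+1 < bpt a k -> pdi k (g (bpt a k)) (bpt a k).

(** At the last degree b_(d+1) = g b_d, so the single number b_d determines both a and f a; the
    parity of d decides which of b_d and g b_d leads to which. *)
Lemma last_iter_f a d : a < n -> last_term a d ->
  (forall i, i < d -> auslander_at a i) ->
  if odd d then iter d./2 f (bpt a d) = a /\ iter d./2.+1 f (g (bpt a d)) = f a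
  else iter d./2 f (bpt a d) = f a /\ iter d./2 f (g (bpt a d)) = a.
Proof.
move=> an ld hd; have /andP[sd _] := ld.
have hd' i : i < d -> pdi i (g (bpt a i)) (bpt a i).
  by move=> id; apply: hd => //; apply: bpt_strict_le sd; apply: ltnW.
have E := bpt_iter_f an sd hd'.
have := E d (leqnSn d); have := E d.+1 (leqnn _).
rewrite -(last_g (ltnW an) ld) oddS; case: ifP => od /= h1 h2.
  by split=> //; move: h1; have -> : uphalf d = d./2.+1 by lia.
by split=> //; move: h1; have -> : uphalf d = d./2 by lia.
Qed.

(** By [last_iter_f] the iterates of g b_d and b_d meet at f a, so a syzygy of the last term
    vanishes by degree d + 1. *)
Lemma last_pdi a d : a < n -> last_term a d ->
  (forall i, i < d -> auslander_at a i) -> pdi d (g (bpt a d)) (bpt a d).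
Proof.
move=> an ld hd; have := last_iter_f an ld hd; set c := bpt a d.
case: ifP => od [h1 h2].
  by apply: (@pdi_odd d d./2.+1); [lia | rewrite h2 iterS h1].
by apply: (@pdi_even d d./2); [lia | rewrite h1 iterS h2].
Qed.

(** If d = d', [last_iter_f] reads off a and a' from the common value c. If d < d', pushing c and g
    c back along the longer coresolution puts its break point of index d' - d - 1 both above f a and
    at most f a. *)
Lemma last_inj a a' d d' : a < n -> a' < n -> last_term a d -> last_term a' d' ->
  (forall i, auslander_at a i) -> (forall i, auslander_at a' i) ->
  bpt a d = bpt a' d' -> a = a'.
Proof.
wlog dd : a a' d d' / d <= d'.
  move=> W an an' l l' h h' e; case/orP: (leq_total d d') => dd; first exact: (W a a' d d').
  by apply: esym; apply: (W a' a d' d).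
move=> an an' l l' h h' e.
have H := last_iter_f an l (fun i _ => h i).
have H' := last_iter_f an' l' (fun i _ => h' i).
have /andP[sd' _] := l'.
have eg := last_g (ltnW an') l'.
move: dd; rewrite leq_eqVlt => /orP[/eqP ed|dd].
  move: H H'; rewrite -e ed /=; case: ifP => _ [h1 h2] [h3 h4].
    by rewrite -h1 -h3.
  by rewrite -h2 -h4.
move: H eg; rewrite -e; set c := bpt a d => H eg.
case: ifP H => od [h1 h2].
  have := @bpt_iter_f_lt a' d' d./2.+1 (d' - d./2.+1.*2) (g c) (ltnW an') sd'.
  have := @bpt_iter_f_ge a' d' d./2.+1 (d' - d./2.+1.*2) (ltnW an') sd'.
  rewrite subnK; last by lia.
  rewrite -e iterS => /(_ (leqW (leqnSn _))) k1 /(_ (leqW (leqnSn _))) k2.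
  have k3 : g c < c by rewrite -eg /c e.
  by move: (k2 k3) k1; rewrite h2 h1; lia.
have sd1 : bpt a' d' < bpt a' d'.-1.
  have := bpt_strict_le (leq_pred d') sd'; case: (d') dd => //.
have := @bpt_iter_f_lt a' d' d./2 (d'.-1 - d./2.*2) c (ltnW an') sd'.
have := @bpt_iter_f_ge a' d' d./2.+1 (d'.-1 - d./2.*2) (ltnW an') sd'.
have -> : d'.-1 - d./2.*2 + (d./2.+1).*2 = d'.+1 by lia.
rewrite subnK; last by lia.
rewrite eg => /(_ (leqnSn _)) k1 k2.
have k3 : iter d./2 f c < bpt a' (d'.-1 - d./2.*2).
  by apply: k2; [lia | rewrite /c e].
by move: k1 k3; rewrite h1 iterS h2; lia.
Qed.

(* In even degrees the Auslander condition is automatic; in odd degree k it is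
   the surjectivity of the last-term map that forces it. *)
Lemma surj_auslander :
  (forall c, 0 < c <= n -> exists a d, [/\ a < n, last_term a d & bpt a d = c]) ->
  forall k a, a < n -> auslander_at a k.
Proof.
move=> surj k; elim/ltn_ind: k => k IH a an sk.
have hd i : i < k -> auslander_at a i by move=> ik; apply: IH.
case/boolP: (last_term a k) => [l|]; first exact: last_pdi.
rewrite /last_term sk /= -ltnNge => sk1.
have hd' i : i < k -> pdi i (g (bpt a i)) (bpt a i).
  by move=> id; apply: hd => //; apply: bpt_strict_le sk; apply: ltnW.
have E := bpt_iter_f an sk hd'.
have := E k (leqnSn k); have := E k.+1 (leqnn _).
rewrite oddS; case: (boolP (odd k)) => ok /= h1 h2; last first.
  (* For even k, f^(k/2) b_k = f a, and f^(k/2+1) (g b_k) <= f^(k/2+1) b_(k+1) = f a. *)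
  apply: (@pdi_even k k./2); first by lia.
  rewrite h2 -{2}[a]/(bpt a 1); apply: leq_trans (_ : f a <= _) => //.
  rewrite -{2}[a]/(bpt a 1) -h1 (_ : uphalf k = k./2); last by lia.
  by rewrite -iterS iter_f_mono // g_bpt_le // ltnW.
have ek : uphalf k = k./2.+1 by lia.
rewrite ek in h1.
(* Take a coresolution whose last term is [g b_k, b_k). If d' <= k, [last_pdi] applies to it; if d'
   > k, its break point of index d' - k - 1 would be both above f a and at most f a. *)
have [|a' [d' [an' l' e]]] := surj (bpt a k).
  by rewrite bpt_le_n ?(ltnW an) // andbT; apply: leq_trans sk.
have /andP[sd' _] := l'.
case: (leqP d' k) => dk.
  rewrite -e; apply: pdi_leq (dk) _; apply: last_pdi => // i id'.
  by apply: IH => //; apply: leq_trans dk.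
have := @bpt_iter_f_lt a' d' k./2.+1 (d' - k./2.+1.*2) (bpt a k.+1) (ltnW an') sd'.
have := @bpt_iter_f_ge a' d' k./2.+1 (d' - k./2.+1.*2) (ltnW an') sd'.
rewrite subnK; last by lia.
rewrite h1 e iterS h2 => k1 k2; have := k1 (leqW (leqnSn _)).
by have := k2 (leqW (leqnSn _)) sk; rewrite -[bpt a 0]/(f (bpt a 1)); lia.
Qed.

Lemma bpt_bound a k : a < n -> bpt a k.+1 < bpt a k -> bpt a k + k <= n.
Proof.
move=> an; elim: k => [|k IH] sk; first by rewrite addn0 f_le_n.
have sk' := bpt_strict_pred sk; have := IH sk'; lia.
Qed.

Lemma exists_last a : a < n -> exists d, last_term a d.
Proof.
move=> an.
have ex : exists d, bpt a d.+1 <= bpt a d.+2.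
  exists n; rewrite leqNgt; apply/negP => /(bpt_bound an) h.
  by have := bpt_strict_pred; rewrite /bpt in h *; lia.
case: (ex_minnP ex) => d hd min; exists d; rewrite /last_term hd andbT.
case: d hd min => [|d] hd min; first exact: lt_f.
rewrite ltnNge; apply/negP => h; have := min d h; by rewrite ltnn.
Qed.

End Combinatorics.

Import GRing.Theory.
Local Open Scope ring_scope.

(** * Path matrices and sums of intervals *)

Section PathMatrix.
Variable K : fieldType.
Implicit Types M N : rep K.

(* The action of the path from i to j, zero unless i <= j; as opposed to
   [pcomp], it is indexed by both end points. *)
Fixpoint pm M (i j : nat) : 'M[K]_(rdim M i, rdim M j) :=
  match j return 'M[K]_(rdim M i, rdim M j) with
  | 0 => if i == 0%N then pid_mx (rdim M i) else 0
  | j'.+1 => if i == j'.+1 then pid_mx (rdim M i) else pm M i j' *m rmap M j'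
  end.

(** A full-size [pid_mx] is the identity, which spares [pm] a cast along i = j. *)
Lemma pmxx M i : pm M i i = 1%:M.
Proof. by case: i => [|i] /=; rewrite ?eqxx pid_mx_1. Qed.

Lemma pmS M i j : (i <= j)%N -> pm M i j.+1 = pm M i j *m rmap M j.
Proof. by move=> ij /=; rewrite ltn_eqF. Qed.

Lemma pm_gt M i j : (j < i)%N -> pm M i j = 0.
Proof.
elim: j => [|j IH] ji /=; first by rewrite gtn_eqF.
by rewrite gtn_eqF // IH ?mul0mx // ltnW.
Qed.

Lemma pm_trans M i j k : (i <= j)%N -> (j <= k)%N ->
  pm M i j *m pm M j k = pm M i k.
Proof.
move=> ij; elim: k => [|k IH] jk.
  by move: jk ij; rewrite leqn0 => /eqP->; rewrite pmxx mulmx1.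
move: jk; rewrite leq_eqVlt => /orP[/eqP<-|jk]; first by rewrite pmxx mulmx1.
by rewrite !pmS ?mulmxA ?IH // (leq_trans ij).
Qed.

Lemma pm_l M i j : (i < j)%N -> rmap M i *m pm M i.+1 j = pm M i j.
Proof.
by move=> ij; rewrite -[RHS](@pm_trans _ i i.+1 j) // pmS // pmxx mul1mx.
Qed.

Lemma pm_hom M N (h : homf M N) i j : is_hom h -> pm M i j *m h j = h i *m pm N i j.
Proof.
move=> hh; case: (leqP i j) => [|ji]; last by rewrite !pm_gt // mul0mx mulmx0.
elim: j => [|j IH]; first by rewrite leqn0 => /eqP->; rewrite !pmxx mul1mx mulmx1.
rewrite leq_eqVlt => /orP[/eqP->|ij]; first by rewrite !pmxx mul1mx mulmx1.
by rewrite !pmS // -mulmxA hh mulmxA IH // mulmxA.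
Qed.

Lemma pcomp_pm M i l : Defs.pcomp M i l = pm M i (l + i).
Proof. by elim: l => [|l IH]; rewrite ?pmxx //= IH ltn_eqF // ltnS leq_addl. Qed.

Section LabelMatrix.
Variable T : eqType.

(** Maps between sums of intervals are identities on common summands. Matching labels describes them
    without reindexing bases. *)
Definition labmx p q (u : 'I_p -> T) (v : 'I_q -> T) : 'M[K]_(p, q) :=
  \matrix_(i, j) (u i == v j)%:R.

Section Action.
Variables (p q r : nat) (u : 'I_p -> T) (v : 'I_q -> T).

Lemma row_labmx (X : 'M_(q, r)) i j : injective v -> v j = u i ->
  row i (labmx u v *m X) = row j X.
Proof.
move=> vi e; rewrite row_mul; apply/rowP => k; rewrite !mxE (bigD1 j) //=.
rewrite !mxE -e eqxx mul1r big1 ?addr0 // => j' nj.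
by rewrite !mxE -e (inj_eq vi) eq_sym (negPf nj) mul0r.
Qed.

Lemma row_labmx0 (X : 'M_(q, r)) i : (forall j, v j <> u i) ->
  row i (labmx u v *m X) = 0.
Proof.
move=> e; rewrite row_mul; apply/rowP => k; rewrite !mxE big1 // => j _.
by rewrite !mxE eq_sym (introF eqP (e j)) mul0r.
Qed.

Lemma col_labmx (X : 'M_(r, p)) i j : injective u -> u i = v j ->
  col j (X *m labmx u v) = col i X.
Proof.
move=> ui e; apply/colP => k; rewrite !mxE (bigD1 i) //=.
rewrite !mxE -e eqxx mulr1 big1 ?addr0 // => i' ni.
by rewrite !mxE -e (inj_eq ui) (negPf ni) mulr0.
Qed.

Lemma col_labmx0 (X : 'M_(r, p)) j : (forall i, u i <> v j) ->
  col j (X *m labmx u v) = 0.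
Proof.
move=> e; apply/colP => k; rewrite !mxE big1 // => i _.
by rewrite !mxE (introF eqP (e i)) mulr0.
Qed.
End Action.

Lemma labmx1 p (u : 'I_p -> T) : injective u -> labmx u u = 1%:M.
Proof. by move=> ui; apply/matrixP => i j; rewrite !mxE (inj_eq ui). Qed.

Section Product.
Variables (p q r : nat) (u : 'I_p -> T) (v : 'I_q -> T) (w : 'I_r -> T).
Hypothesis vi : injective v.

Lemma labmx_mul :
  (forall i k, u i = w k -> exists j, v j = u i) -> labmx u v *m labmx v w = labmx u w.
Proof.
move=> H; apply/row_matrixP => i.
case: (pickP (fun j => v j == u i)) => [j /eqP e|e].
  by rewrite (row_labmx _ vi e); apply/rowP => k; rewrite !mxE e.
rewrite row_labmx0; last by move=> j /eqP; rewrite e.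
apply/rowP => k; rewrite !mxE; case: eqP => // /H[j /eqP]; by rewrite e.
Qed.

Lemma labmx_mul0 : (forall i j k, v j = u i -> v j <> w k) -> labmx u v *m labmx v w = 0.
Proof.
move=> H; apply/row_matrixP => i; rewrite row0.
case: (pickP (fun j => v j == u i)) => [j /eqP e|e].
  rewrite (row_labmx _ vi e); apply/rowP => k; rewrite !mxE.
  by rewrite (introF eqP (H _ _ _ e)).
by rewrite row_labmx0 // => j /eqP; rewrite e.
Qed.

(** This is the exactness criterion: the coordinates of X whose label survives in w are zero, and
    the other labels come from u. *)
Lemma sub_labmx (X : 'rV_q) : injective w -> X *m labmx v w = 0 ->
  (forall j, (exists k, w k = v j) \/ (exists i, u i = v j)) -> (X <= labmx u v)%MS.
Proof.
move=> wi X0 H; rewrite (row_sum_delta X) summx_sub // => j _.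
case: (H j) => [[k e]|[i e]].
  suff -> : X 0 j = 0 by rewrite scale0r sub0mx.
  by have := congr1 (fun Y : 'M_(_, _) => col k Y 0 0) X0; rewrite (col_labmx _ vi (esym e)) !mxE.
apply: scalemx_sub; suff -> : delta_mx 0 j = row i (labmx u v) by apply: row_sub.
by apply/rowP => k; rewrite !mxE e (inj_eq vi) eqxx eq_sym.
Qed.
End Product.
End LabelMatrix.
End PathMatrix.

Lemma matrix_colP (R : Type) m n (X Y : 'M[R]_(m, n)) : (forall j, col j X = col j Y) -> X = Y.
Proof. by move=> e; apply/matrixP => i j; have /colP/(_ i) := e j; rewrite !mxE. Qed.

Lemma col_mulmx (R : pzSemiRingType) m n p (X : 'M[R]_(m, n)) (Y : 'M[R]_(n, p)) j :
  col j (X *m Y) = X *m col j Y.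
Proof. by rewrite !colE mulmxA. Qed.

Section Labelled.
Variable K : fieldType.
Implicit Types M N : rep K.

(* M is a direct sum of interval modules [A x, B x), indexed by x in T, where
   the basis vector i of M at vertex k belongs to the summand [lab k i]. *)
Record labelled M (T : eqType) (lab : forall k, 'I_(rdim M k) -> T) (A B : T -> nat) : Prop :=
  Labelled {
    lab_inj : forall k, injective (lab k);
    lab_mem : forall k i, (A (lab k i) <= k < B (lab k i))%N;
    lab_ex : forall k x, (A x <= k < B x)%N -> exists i, lab k i = x;
    lab_map : forall k, rmap M k = labmx K (lab k) (lab k.+1)
  }.

Section OneLabelled.
Variables (T : eqType) (M : rep K) (lab : forall k, 'I_(rdim M k) -> T) (A B : T -> nat).
Hypothesis ML : labelled lab A B.

Lemma pm_lab i j : (i <= j)%N -> pm M i j = labmx K (@lab i) (@lab j).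
Proof.
elim: j => [|j IH]; first by rewrite leqn0 => /eqP->; rewrite pmxx labmx1 //; apply: (lab_inj ML).
rewrite leq_eqVlt => /orP[/eqP->|ij]; first by rewrite pmxx labmx1 //; apply: (lab_inj ML).
rewrite pmS // IH // (lab_map ML) labmx_mul //; first exact: (lab_inj ML).
move=> p q e; apply: (lab_ex ML).
by have := lab_mem ML p; have := lab_mem ML q; rewrite e; lia.
Qed.

Lemma row_pm_lab r i j p q (X : 'M_(rdim M j, r)) : (i <= j)%N -> lab q = lab p ->
  row p (pm M i j *m X) = row q X.
Proof. by move=> ij e; rewrite pm_lab // (row_labmx _ _ e) //; apply: (lab_inj ML). Qed.

Lemma col_pm_lab r i j p q (X : 'M_(r, rdim M i)) : (i <= j)%N -> lab q = lab p ->
  col p (X *m pm M i j) = col q X.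
Proof. by move=> ij e; rewrite pm_lab // (col_labmx _ _ e) //; apply: (lab_inj ML). Qed.

(** An interval is generated at its first vertex A x, so a morphism out of it is a vector there,
    killed by the path to B x. *)
Definition hom_out N (v : forall x, 'rV[K]_(rdim N (A x))) : homf M N :=
  fun k => \matrix_i (v (lab i) *m pm N (A (lab i)) k).

Lemma hom_out_is_hom N v :
  (forall x, (A x < B x)%N -> v x *m pm N (A x) (B x) = 0) -> is_hom (@hom_out N v).
Proof.
move=> v0 k; apply/row_matrixP => i; rewrite [in RHS]row_mul rowK -mulmxA.
have /andP[Ai iB] := lab_mem ML i.
rewrite -pmS // (lab_map ML); case: (ltnP k.+1 (B (lab i))) => kB.
  have [|j ej] := lab_ex ML (k := k.+1) (x := lab i); first by rewrite kB ltnW.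
  by rewrite (row_labmx _ (lab_inj ML (k:=k.+1)) ej) rowK ej.
rewrite row_labmx0.
  have -> : k.+1 = B (lab i) by lia.
  by rewrite v0 // (leq_ltn_trans Ai).
by move=> j ej; have := lab_mem ML j; rewrite ej; lia.
Qed.

(** Dually, a morphism into an interval is a functional at its socle vertex B x - 1, vanishing on
    paths that start before A x. *)
Definition hom_in N (l : forall x, 'cV[K]_(rdim N (B x).-1)) : homf N M :=
  fun k => \matrix_(p, q) (pm N k (B (lab q)).-1 *m l (lab q)) p 0.

Lemma col_hom_in N l k q : col q (@hom_in N l k) = pm N k (B (lab q)).-1 *m l (lab q).
Proof. by apply/colP => p; rewrite mxE mxE. Qed.

Lemma hom_in_is_hom N l :
  (forall x s, (A x < B x)%N -> (s < A x)%N -> pm N s (B x).-1 *m l x = 0) ->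
  is_hom (@hom_in N l).
Proof.
move=> l0 k; apply: matrix_colP => j.
have /andP[Aj jB] := lab_mem ML j.
rewrite col_mulmx col_hom_in mulmxA pm_l; last by lia.
rewrite (lab_map ML); case: (leqP (A (lab j)) k) => Ak.
  have [|i ei] := lab_ex ML (k := k) (x := lab j); first by rewrite Ak ltnW.
  by rewrite (col_labmx _ (lab_inj ML (k:=k)) ei) col_hom_in ei.
rewrite col_labmx0; first by rewrite l0 // (leq_ltn_trans Aj).
by move=> i ei; have := lab_mem ML i; rewrite ei; lia.
Qed.

End OneLabelled.

Section Diagonal.
Variables (T : eqType) (M1 M2 : rep K).
Variables (u1 : forall k, 'I_(rdim M1 k) -> T) (u2 : forall k, 'I_(rdim M2 k) -> T).
Variables A1 B1 A2 B2 : T -> nat.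
Hypotheses (L1 : labelled u1 A1 B1) (L2 : labelled u2 A2 B2).

Definition diag_hom : homf M1 M2 := fun k => labmx K (@u1 k) (@u2 k).

(** Each composite of the square at k matches equal labels or is zero: one passes through the source
    at k + 1, the other through the target at k, and the condition makes x present in both or in
    neither. *)
Lemma diag_is_hom :
  (forall x k, (A1 x <= k < B1 x)%N -> (A2 x <= k.+1 < B2 x)%N ->
     (k.+1 < B1 x)%N = (A2 x <= k)%N) ->
  is_hom diag_hom.
Proof.
move=> H k; rewrite (lab_map L1) (lab_map L2) /diag_hom.
apply/matrixP => i j; have mi := lab_mem L1 i; have mj := lab_mem L2 j.
case: (eqVneq (u1 i) (u2 j)) => [e|ne]; last first.
  rewrite !mxE !big1 // => p _; rewrite !mxE.
    by case: eqP => [e1|_]; rewrite ?mul0r // -e1 (negPf ne) mulr0.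
  by case: eqP => [e1|_]; rewrite ?mul0r // -e1 (negPf ne) mulr0.
have Hij := H (u1 i) k mi; rewrite {1 2}e in Hij.
have {}Hij := Hij mj; case: (ltnP k.+1 (B1 (u1 i))) Hij => [h1 /esym h2|h1 /esym h2].
  have [|p ep] := lab_ex L1 (k := k.+1) (x := u1 i); first by rewrite h1; lia.
  have [|q eq] := lab_ex L2 (k := k) (x := u1 i); first by rewrite h2 e; lia.
  have := row_labmx (labmx K (@u1 k.+1) (@u2 k.+1)) (lab_inj L1 (k:=k.+1)) ep.
  have := row_labmx (labmx K (@u2 k) (@u2 k.+1)) (lab_inj L2 (k:=k)) eq.
  move=> /rowP/(_ j); rewrite !mxE => ->; move=> /rowP/(_ j); rewrite !mxE => ->.
  by rewrite ep eq.
have := @row_labmx0 K T _ _ _ (@u1 k) (@u1 k.+1) (labmx K (@u1 k.+1) (@u2 k.+1)) i.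
have := @row_labmx0 K T _ _ _ (@u1 k) (@u2 k) (labmx K (@u2 k) (@u2 k.+1)) i.
move=> H1 H2; have {}H1 : row i (labmx K (@u1 k) (@u2 k) *m labmx K (@u2 k) (@u2 k.+1)) = 0.
  by apply: H1 => p ep; have := lab_mem L2 p; rewrite ep h2.
have {}H2 : row i (labmx K (@u1 k) (@u1 k.+1) *m labmx K (@u1 k.+1) (@u2 k.+1)) = 0.
  by apply: H2 => p ep; have := lab_mem L1 p; rewrite ep; lia.
move: H1 H2 => /rowP/(_ j); rewrite [LHS]mxE => ->.
by move=> /rowP/(_ j); rewrite [LHS]mxE => ->.
Qed.

Lemma diag_mono :
  (forall x k, (A1 x <= k < B1 x)%N -> (A2 x <= k < B2 x)%N) -> mono diag_hom.
Proof.
move=> H k; apply/row_freeP; exists (labmx K (@u2 k) (@u1 k)); rewrite labmx_mul ?labmx1 //.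
- exact: (lab_inj L1).
- exact: (lab_inj L2).
by move=> i _ _; apply: (lab_ex L2); apply: H; apply: (lab_mem L1).
Qed.

Lemma diag_epi :
  (forall x k, (A2 x <= k < B2 x)%N -> (A1 x <= k < B1 x)%N) -> epi diag_hom.
Proof.
move=> H k; apply/row_fullP; exists (labmx K (@u2 k) (@u1 k)); rewrite labmx_mul ?labmx1 //.
- exact: (lab_inj L2).
- exact: (lab_inj L1).
by move=> i _ _; apply: (lab_ex L1); apply: H; apply: (lab_mem L2).
Qed.

End Diagonal.

Lemma diag_exact (T : eqType) (M1 M2 M3 : rep K) (u1 : forall k, 'I_(rdim M1 k) -> T)
    (u2 : forall k, 'I_(rdim M2 k) -> T) (u3 : forall k, 'I_(rdim M3 k) -> T)
    (A1 B1 A2 B2 A3 B3 : T -> nat) :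
  labelled u1 A1 B1 -> labelled u2 A2 B2 -> labelled u3 A3 B3 ->
  (forall x k, (A2 x <= k < B2 x)%N ->
     (A1 x <= k < B1 x)%N = ~~ (A3 x <= k < B3 x)%N) ->
  exact_at (diag_hom u1 u2) (diag_hom u2 u3).
Proof.
move=> L1 L2 L3 H k; rewrite /diag_hom; apply/andP; split.
  apply/sub_kermxP; rewrite labmx_mul0 //; first exact: (lab_inj L2).
  move=> i j l e1 e2; have := H (u2 k j) k (lab_mem L2 j).
  by rewrite {1 2}e1 (lab_mem L1) e2 (lab_mem L3).
apply/row_subP => i; have K0 := mulmx_ker (labmx K (u2 k) (u3 k)).
have := congr1 (row i) K0; rewrite row_mul row0 => Ki0.
apply: (sub_labmx (lab_inj L2 (k:=k)) (lab_inj L3 (k:=k)) Ki0) => j.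
have := H (u2 k j) k (lab_mem L2 j).
case: (boolP (A3 _ <= _ < _)%N) => [h3 _|_ h1]; first by left; apply: (lab_ex L3).
by right; apply: (lab_ex L1).
Qed.

Section IntervalSum.
Variables (T : finType) (A B : T -> nat).

Definition supp k : {set T} := [set x | (A x <= k < B x)%N].
Definition isum : rep K :=
  @Rep K (fun k => #|supp k|)
    (fun k => labmx K (fun i : 'I_(#|supp k|) => enum_val i)
                      (fun i : 'I_(#|supp k.+1|) => enum_val i)).
Definition isum_lab k : 'I_(rdim isum k) -> T := fun i => @enum_val T (mem (supp k)) i.

Lemma isum_labelled : labelled isum_lab A B.
Proof.
split=> //= [k|k i|k x hx].
- exact: enum_val_inj.
- by have := enum_valP i; rewrite inE.
have xs : x \in supp k by rewrite inE.
by exists (enum_rank_in xs x); rewrite /isum_lab enum_rankK_in.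
Qed.
End IntervalSum.
End Labelled.
Arguments isum_lab {K T} A B k _.

(** * Projective and injective modules *)

Lemma mx_dim0 (K : fieldType) m n (X Y : 'M[K]_(m, n)) : m = 0%N \/ n = 0%N -> X = Y.
Proof. by case=> e; subst; rewrite [X]flatmx0 [Y]flatmx0 || rewrite [X]thinmx0 [Y]thinmx0. Qed.

Section Modules.
Variables (K : fieldType) (n : nat) (S : nat -> nat -> bool) (f g : nat -> nat).
Hypothesis gal : forall b x, (b <= n)%N -> (g b <= x)%N = (b <= f x)%N.
Hypothesis f_le_n : forall x, (f x <= n)%N.
Hypothesis lt_f : forall x, (x < n)%N -> (x < f x)%N.
Hypothesis S_f : forall i j, (i <= j)%N -> S i j = (f i <= j)%N && (j < n)%N.
Implicit Types M N P J : rep K.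

Lemma rdim_big M k : is_rep n S M -> (n <= k)%N -> rdim M k = 0%N.
Proof. by case=> h _; apply: h. Qed.

Lemma pm_f0 M i j : is_rep n S M -> (f i <= j)%N -> pm M i j = 0.
Proof.
case=> h1 h2 fij; case: (ltnP j i) => [ji|ij]; first exact: pm_gt.
case: (ltnP j n) => jn; last by apply: mx_dim0; right; apply: h1.
have [l e] : exists l, j = (l + i)%N by exists (j - i)%N; rewrite subnK.
by subst j; rewrite -pcomp_pm h2 // S_f // fij.
Qed.

Lemma pm_is_rep M : (forall k, (n <= k)%N -> rdim M k = 0%N) ->
  (forall i j, (f i <= j)%N -> pm M i j = 0) -> is_rep n S M.
Proof.
move=> h1 h2; split=> // i l; rewrite S_f ?leq_addl // => /andP[fi _].
by rewrite pcomp_pm h2.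
Qed.

Section LabelledModules.
Variables (T : eqType) (M : rep K) (lab : forall k, 'I_(rdim M k) -> T) (A B : T -> nat).
Hypothesis ML : labelled lab A B.

Lemma lab_is_rep : (forall x, (A x < B x)%N -> (B x <= f (A x))%N) -> is_rep n S M.
Proof.
move=> AB; apply: pm_is_rep => [k nk|i j fij].
  apply/eqP; rewrite -leqn0 leqNgt; apply/negP => h.
  have := lab_mem ML (Ordinal h); set x := lab _ => /andP[xA xB].
  by have := AB x (leq_ltn_trans xA xB); have := f_le_n (A x); lia.
case: (ltnP j i) => [ji|ij]; first exact: pm_gt.
rewrite (pm_lab ML ij); apply/matrixP => p q; rewrite !mxE; case: eqP => // e.
have := lab_mem ML p; have := lab_mem ML q; rewrite -e; set x := lab p.
move=> /andP[h1 h2] /andP[h3 h4]; have := AB x (leq_ltn_trans h3 h4).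
by have := f_mono gal f_le_n h3; lia.
Qed.

Lemma lab_projective : (forall x, (A x < B x)%N -> B x = f (A x)) -> projective n S M.
Proof.
move=> AB; split; first by apply: lab_is_rep => x /AB->.
move=> M' N e h rM' rN he ee hh.
(* Lift the generators at their own vertices; the relations hold since paths from A x to f (A x) are
   zero. The default 0 concerns empty intervals only. *)
pose v x : 'rV[K]_(rdim M' (A x)) :=
  if [pick p | @lab (A x) p == x] is Some p then row p (h (A x)) *m pinvmx (e (A x)) else 0.
exists (hom_out lab v); split.
  apply: (hom_out_is_hom ML) => x ABx; by rewrite (pm_f0 rM') ?mulmx0 // AB.
move=> k; apply/row_matrixP => i; rewrite row_mul rowK -mulmxA pm_hom // mulmxA.
have /andP[Ai iB] := lab_mem ML i.
rewrite /v; case: pickP => [p /eqP ep|].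
  rewrite mulmxKpV ?submx_full //.
  by rewrite -row_mul -pm_hom // (row_pm_lab ML (q := i)) // ep.
have [|p ep] := lab_ex ML (k := A (lab i)) (x := lab i).
  by rewrite leqnn /=; lia.
by move=> /(_ p); rewrite ep eqxx.
Qed.

Lemma lab_injective : (forall x, (A x < B x)%N -> (B x <= n)%N /\ A x = g (B x)) ->
  Defs.injective n S M.
Proof.
move=> AB; split.
  by apply: lab_is_rep => x /AB[Bn ->]; rewrite (leq_fg gal).
move=> M' N m h rM' rN hm mm hh.
(* Extend the socle functionals along the monomorphism; paths into B x - 1 starting before A x = g
   (B x) are zero. *)
pose l x : 'cV[K]_(rdim N (B x).-1) :=
  if [pick q | @lab (B x).-1 q == x] is Some q
  then pinvmx (m (B x).-1) *m col q (h (B x).-1) else 0.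
exists (hom_in lab l); split.
  apply: (hom_in_is_hom ML) => x s /AB[Bn Ax] sA; rewrite (pm_f0 rN) ?mul0mx //.
  by rewrite -ltnS (leq_trans _ (leqSpred _)) // ltnNge -gal // -Ax -ltnNge.
move=> k; apply: matrix_colP => j; rewrite col_mulmx col_hom_in mulmxA -pm_hom // -mulmxA.
have /andP[Aj jB] := lab_mem ML j.
rewrite /l; case: pickP => [q /eqP eq|].
  rewrite (mulmxA (m _)) mulmxVp // mul1mx -col_mulmx pm_hom //.
  by rewrite (col_pm_lab ML (q := j)) //; lia.
have [|p ep] := lab_ex ML (k := (B (lab j)).-1) (x := lab j); first by lia.
by move=> /(_ p); rewrite ep eqxx.
Qed.

End LabelledModules.

Definition ivl (x y : nat) : rep K := isum K (fun _ : unit => x) (fun _ => y).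
Definition ivl_lab x y : forall k, 'I_(rdim (ivl x y) k) -> unit :=
  isum_lab (fun _ => x) (fun _ => y).
Arguments ivl_lab : clear implicits.

Lemma ivl_labelled x y :
  @labelled K (ivl x y) unit (ivl_lab x y) (fun _ => x) (fun _ => y).
Proof. exact: isum_labelled. Qed.

Lemma ivl_ex x y k : (x <= k < y)%N -> exists i : 'I_(rdim (ivl x y) k), True.
Proof. by move=> h; have [|i _] := lab_ex (ivl_labelled x y) (k := k) (x := tt). Qed.

Let unitE (a b : unit) : a = b. Proof. by case: a; case: b. Qed.

(** Test injectivity on the inclusion of [t, b) in [x, b). *)
Lemma injective_extend J x t b (u : 'rV_(rdim J t)) :
  Defs.injective n S J -> (x <= t < b)%N -> (b <= f x)%N -> u *m pm J t b = 0 ->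
  exists u' : 'rV_(rdim J x), u' *m pm J x t = u.
Proof.
move=> [rJ iJ] /andP[xt tb] bf u0.
pose h : homf (ivl t b) J := hom_out (ivl_lab t b) (A := fun=> t) (fun=> u).
have hh : is_hom h by apply: (hom_out_is_hom (ivl_labelled t b)).
have rM : is_rep n S (ivl t b).
  apply: (lab_is_rep (ivl_labelled t b)) => _ _.
  by apply: leq_trans bf _; apply: f_mono gal f_le_n _ _ _.
have rN : is_rep n S (ivl x b) by apply: (lab_is_rep (ivl_labelled x b)).
have hm : is_hom (diag_hom (ivl_lab t b) (ivl_lab x b)).
  by apply: (diag_is_hom (ivl_labelled t b) (ivl_labelled x b)) => _ k /=; lia.
have mm : mono (diag_hom (ivl_lab t b) (ivl_lab x b)).
  by apply: (diag_mono (ivl_labelled t b) (ivl_labelled x b)) => _ k /=; lia.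
have [h' [hh' eh]] := iJ _ _ _ h rM rN hm mm hh.
have [i _] := ivl_ex (x := t) (y := b) (k := t) ltac:(lia).
have [j _] := ivl_ex (x := x) (y := b) (k := t) ltac:(lia).
have [p _] := ivl_ex (x := x) (y := b) (k := x) ltac:(lia).
exists (row p (h' x)); rewrite -row_mul -(pm_hom _ _ hh').
rewrite (row_pm_lab (ivl_labelled x b) (p := p) (q := j) _ xt (unitE _ _)).
have := congr1 (row i) (eh t); rewrite (row_labmx _ _ (unitE (ivl_lab x b t j) _)).
  by move=> ->; rewrite rowK pmxx mulmx1.
exact: (lab_inj (ivl_labelled x b)).
Qed.

(** Test projectivity on the surjection of [x, z) onto [x, y), with morphisms into intervals written
    as functionals. *)
Lemma projective_extend P x y z (l : 'cV_(rdim P y.-1)) :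
  projective n S P -> (x < y)%N -> (y <= z <= f x)%N ->
  (forall s, (s < x)%N -> pm P s y.-1 *m l = 0) ->
  exists2 l' : 'cV_(rdim P z.-1), pm P y.-1 z.-1 *m l' = l &
    forall s, (s < x)%N -> pm P s z.-1 *m l' = 0.
Proof.
move=> [rP pP] xy /andP[yz zf] l0.
pose h : homf P (ivl x y) := hom_in (ivl_lab x y) (B := fun=> y) (fun=> l).
have hh : is_hom h.
  by apply: (hom_in_is_hom (ivl_labelled x y)) => _ s _; apply: l0.
have rM : is_rep n S (ivl x z) by apply: (lab_is_rep (ivl_labelled x z)).
have rN : is_rep n S (ivl x y).
  by apply: (lab_is_rep (ivl_labelled x y)) => _ _; apply: leq_trans zf.
have he : is_hom (diag_hom (ivl_lab x z) (ivl_lab x y)).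
  by apply: (diag_is_hom (ivl_labelled x z) (ivl_labelled x y)) => _ k /=; lia.
have ee : epi (diag_hom (ivl_lab x z) (ivl_lab x y)).
  by apply: (diag_epi (ivl_labelled x z) (ivl_labelled x y)) => _ k /=; lia.
have [h' [hh' eh]] := pP _ _ _ h rM rN he ee hh.
have [i _] := ivl_ex (x := x) (y := y) (k := y.-1) ltac:(lia).
have [j _] := ivl_ex (x := x) (y := z) (k := y.-1) ltac:(lia).
have [q _] := ivl_ex (x := x) (y := z) (k := z.-1) ltac:(lia).
exists (col q (h' z.-1)).
  rewrite -col_mulmx (pm_hom _ _ hh').
  rewrite (col_pm_lab (ivl_labelled x z) (p := q) (q := j) _ _ (unitE _ _)); last by lia.
  have := congr1 (col i) (eh y.-1); rewrite (col_labmx _ _ (unitE (ivl_lab x z y.-1 j) _)).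
    by move=> ->; rewrite col_hom_in pmxx mul1mx.
  exact: (lab_inj (ivl_labelled x z)).
move=> s sx; rewrite -col_mulmx (pm_hom _ _ hh').
rewrite [pm _ s _](mx_dim0 _ 0) ?mulmx0; first by rewrite colE mul0mx.
left; apply/eqP; rewrite -leqn0 leqNgt; apply/negP => hs.
by have := lab_mem (ivl_labelled x z) (Ordinal hs); lia.
Qed.

End Modules.

(** * Lower bounds from resolutions *)

(** A functional vanishing on the kernel of a map factors through that map. *)
Lemma mulmx_solve (K : fieldType) m p q (X : 'M[K]_(m, p)) (Y : 'M[K]_(m, q)) :
  kermx X *m Y = 0 -> X *m (pinvmx X *m Y) = Y.
Proof.
move=> kY; have /submxP[Z eZ] : (1%:M - X *m pinvmx X <= kermx X)%MS.
  by apply/sub_kermxP; rewrite mulmxBl mul1mx mulmxKpV // subrr.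
have : (1%:M - X *m pinvmx X) *m Y = 0 by rewrite eZ -mulmxA kY mulmx0.
by rewrite mulmxBl mul1mx mulmxA => /eqP; rewrite subr_eq0 => /eqP.
Qed.

Lemma submx_dim0 (K : fieldType) m p q (X : 'M[K]_(m, q)) (Y : 'M[K]_(p, q)) :
  (X <= Y)%MS -> p = 0%N -> X = 0.
Proof. by case/submxP=> Z -> p0; subst p; rewrite [Y]flatmx0 mulmx0. Qed.

Section Resolutions.
Variables (K : fieldType) (n : nat) (S : nat -> nat -> bool) (f g : nat -> nat).
Hypothesis gal : forall b x, (b <= n)%N -> (g b <= x)%N = (b <= f x)%N.
Hypothesis f_le_n : forall x, (f x <= n)%N.
Hypothesis lt_f : forall x, (x < n)%N -> (x < f x)%N.
Hypothesis S_f : forall i j, (i <= j)%N -> S i j = (f i <= j)%N && (j < n)%N.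
Implicit Types M N P J : rep K.

(** One step along a projective resolution: the vector lifts, the functional pulls back and extends
    to f y - 1, and their pairing is unchanged, hence stays nonzero. *)
Lemma projective_step P N (e : homf P N) y z (w : 'rV_(rdim N y)) (l : 'cV_(rdim N z.-1)) :
  projective n S P -> is_hom e -> (y < z <= f y)%N -> (w <= e y)%MS ->
  (forall s, (s < y)%N -> e s *m (pm N s z.-1 *m l) = 0) ->
  exists (s : 'rV_(rdim P y)) (l' : 'cV_(rdim P (f y).-1)),
    [/\ s *m e y = w, pm P z.-1 (f y).-1 *m l' = e z.-1 *m l &
        s *m pm P y (f y).-1 *m l' = w *m pm N y z.-1 *m l].
Proof.
move=> pP he /andP[yz zf] /submxP[s es] l0.
have [||s' s'y|l' el' _] := projective_extend gal f_le_n S_f (y := z) (z := f y) (x := y)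
    (l := e z.-1 *m l) pP => //; first by rewrite zf leqnn.
  by rewrite mulmxA pm_hom // -mulmxA l0.
exists s, l'; split=> //.
rewrite -(@pm_trans _ P y z.-1) ?mulmxA; [|lia|lia].
by rewrite -(mulmxA _ _ l') el' !mulmxA -(mulmxA s) pm_hom // mulmxA -es.
Qed.

(** The dual step along an injective coresolution: the image of the vector is pulled back to x, the
    functional factors through d, and the pairing is kept. *)
Lemma injective_step J N (d : homf N J) x y z (w : 'rV_(rdim N y)) (l : 'cV_(rdim N z.-1)) :
  Defs.injective n S J -> is_hom d -> (x <= y < z)%N -> (z <= f x)%N ->
  w *m pm N y z *m d z = 0 ->
  (kermx (d z.-1) *m l = 0) ->
  exists (u : 'rV_(rdim J x)) (l' : 'cV_(rdim J z.-1)),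
    [/\ u *m pm J x y = w *m d y, d z.-1 *m l' = l &
        u *m pm J x z.-1 *m l' = w *m pm N y z.-1 *m l].
Proof.
move=> iJ hd /andP[xy yz] zf w0 kl.
have [|||u eu] := injective_extend gal f_le_n S_f (x := x) (t := y) (b := z) (u := w *m d y) iJ.
- by rewrite xy.
- by [].
- by rewrite -mulmxA -pm_hom // mulmxA.
have el' := mulmx_solve kl; set l' := pinvmx _ *m l in el'.
exists u, l'; split=> //.
rewrite -(@pm_trans _ J x y z.-1) //; last by lia.
by rewrite mulmxA eu -!mulmxA (mulmxA (d y)) -pm_hom // -mulmxA el'.
Qed.

Lemma syzygy_class P1 P N (d : homf P1 P) (e : homf P N) x y
    (s : 'rV_(rdim P x)) (w : 'rV_(rdim N x)) :
  is_hom e -> exact_at d e -> s *m e x = w -> w *m pm N x y = 0 ->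
  (s *m pm P x y <= d y)%MS.
Proof.
move=> he ede es w0; have /andP[_] := ede y; apply: submx_trans.
by apply/sub_kermxP; rewrite -mulmxA pm_hom // mulmxA es.
Qed.

(* A class in N that survives under the functional l can be pushed along any
   projective resolution of N, so the resolution is at least as long as that of
   the interval module [x, y) of which N contains a retract. *)
Lemma pd_lower m x y N (P : nat -> rep K) (d : forall j, homf (P j.+1) (P j))
    (e : homf (P 0) N) (w : 'rV_(rdim N x)) (l : 'cV_(rdim N y.-1)) :
  (forall j, projective n S (P j)) -> (forall j, (m < j)%N -> is_zero_rep (P j)) ->
  (forall j, is_hom (d j)) -> is_hom e -> exact_at (d 0%N) e ->
  (forall j, exact_at (d j.+1) (d j)) ->
  (x < y)%N -> (y <= f x)%N -> (w <= e x)%MS -> w *m pm N x y = 0 ->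
  (forall s, (s < x)%N -> e s *m (pm N s y.-1 *m l) = 0) ->
  w *m pm N x y.-1 *m l = 1%:M -> pdi f m x y.
Proof.
elim: m x y N P d e w l => [|m IH] x y N P d e w l pP zP hd he ede edd xy yf we w0 l0 wl /=;
  rewrite [(y <= x)%N]leqNgt xy /=.
  have [|s [l' [es _ sl']]] := projective_step (z := y) (w := w) (l := l) (pP 0%N) he _ we l0.
    by rewrite xy.
  rewrite wl in sl'; rewrite leqNgt; apply/negP => yfx; move: sl'.
  rewrite -(@pm_trans _ _ x y) ?(ltnW xy) //; last by lia.
  (* This product comes from the zero module in degree 1, so the pairing would be 0 instead of 1. *)
  have -> : s *m (pm (P 0%N) x y *m pm (P 0%N) y (f x).-1) = 0.
    have sk : (s *m pm (P 0%N) x y <= d 0%N y)%MS.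
      by apply: (syzygy_class he ede es).
    by rewrite mulmxA (submx_dim0 sk) ?mul0mx //; apply: zP.
  by rewrite mul0mx => /esym/matrixP/(_ 0 0); rewrite !mxE; apply/eqP; rewrite oner_eq0.
case: (leqP (f x) y) => [fy|yfx]; first by case: (m) => [|m'] /=; rewrite fy.
have [|s [l' [es el' sl']]] := projective_step (z := y) (w := w) (l := l) (pP 0%N) he _ we l0.
  by rewrite xy ltnW.
rewrite wl in sl'; have sk := syzygy_class he ede es w0.
(* The syzygy of [x, y) is [y, f x); its class is the lift s moved to y, tested by l'. *)
apply: (IH y (f x) (P 0%N) (fun j => P j.+1) (fun j => d j.+1) (d 0%N)
  (s *m pm (P 0%N) x y) l') => //.
- by move=> j mj; apply: zP.
- by apply: (f_mono gal f_le_n); apply: ltnW.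
- rewrite -mulmxA pm_trans ?(ltnW xy) // (pm_f0 S_f) ?mulmx0 //; first by case: (pP 0%N).
- move=> t ty; have -> : pm (P 0%N) t (f x).-1 = pm (P 0%N) t y.-1 *m pm (P 0%N) y.-1 (f x).-1.
    by rewrite pm_trans //; lia.
  rewrite -(mulmxA (pm _ _ _)) el' !mulmxA -pm_hom // -(mulmxA _ (d 0%N _)).
  suff -> : d 0%N y.-1 *m e y.-1 = 0 by rewrite mulmx0 mul0mx.
  by apply/sub_kermxP; case/andP: (ede y.-1).
by rewrite -(mulmxA s) pm_trans ?(ltnW xy) //; lia.
Qed.

Section Forward.
Variables (R : rep K) (lab : forall k, 'I_(rdim R k) -> 'I_n.+1).
Hypothesis RL : labelled lab (fun x => nat_of_ord x) (fun x => f x).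
Variables (J : nat -> rep K) (iota : homf R (J 0%N)) (dl : forall j, homf (J j) (J j.+1)).
Hypotheses (iJ : forall j, Defs.injective n S (J j)) (hi : is_hom iota)
  (hd : forall j, is_hom (dl j)) (mi : mono iota) (ei : exact_at iota (dl 0%N))
  (ed : forall j, exact_at (dl j) (dl j.+1)).

(** The coresolution with [R] put in front, so that [D k] is the map into J_k for k = 0 as well. *)
Let Q k : rep K := if k is k'.+1 then J k' else R.
Let D k : homf (Q k) (Q k.+1) :=
  match k return homf (Q k) (Q k.+1) with 0 => iota | k'.+1 => dl k' end.
Let b a k := bpt f g a k.

(* The socle of the k-th term of the minimal coresolution of [a, f a) survives
   in the k-th term of any injective coresolution of the regular module. *)
Lemma coresolution_class a k : (a < n)%N -> (b a k.+1 < b a k)%N ->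
  exists (u : 'rV_(rdim (J k) (g (b a k)))) (l : 'cV_(rdim (J k) (b a k).-1)),
    [/\ (u *m pm (J k) (g (b a k)) (b a k.+1) <= D k (b a k.+1))%MS,
        (0 < b a k.+1)%N ->
          D k (b a k.+1).-1 *m (pm (J k) (b a k.+1).-1 (b a k).-1 *m l) = 0,
        u *m pm (J k) (g (b a k)) (b a k) = 0 &
        u *m pm (J k) (g (b a k)) (b a k).-1 *m l = 1%:M].
Proof.
move=> an; have an' := ltnW an.
have zero_end k' (N : rep K) (u : 'rV_(rdim (J k') (g (b a k')))) (d : homf N (J k')) w :
    is_hom d -> (b a k'.+1 <= b a k')%N -> w *m pm N (b a k'.+1) (b a k') *m d (b a k') = 0 ->
    u *m pm (J k') (g (b a k')) (b a k'.+1) = w *m d (b a k'.+1) ->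
    u *m pm (J k') (g (b a k')) (b a k') = 0.
  move=> hd' bb w0 eu; rewrite -(@pm_trans _ _ _ (b a k'.+1)) //; last exact: (g_bpt_le gal f_le_n lt_f).
  by rewrite mulmxA eu -mulmxA -pm_hom // mulmxA.
elim: k => [|k IH] sk.
  have iR : is_rep n S R by apply: (lab_is_rep gal f_le_n S_f RL).
  have an1 : (a < n.+1)%N by lia.
  have [|p ep] := lab_ex RL (k := a) (x := Ordinal an1); first by move: (lt_f an); rewrite /=; lia.
  have [|q eq] := lab_ex RL (k := (f a).-1) (x := Ordinal an1).
    by have := lt_f an; rewrite /=; lia.
  (* The generator of the summand [a, f a) and the functional dual to its socle vector. *)
  pose w : 'rV[K]_(rdim R a) := delta_mx 0 p.
  pose l0 : 'cV[K]_(rdim R (f a).-1) := delta_mx q 0.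
  have w0 : w *m pm R a (f a) *m iota (f a) = 0 by rewrite (pm_f0 S_f iR) ?mulmx0 ?mul0mx.
  have [|||u [l [eu el ul]]] := injective_step (x := g (f a)) (y := a) (z := f a)
    (w := w) (l := l0) (iJ 0%N) hi _ _ w0.
  - by rewrite gal ?leqnn ?lt_f.
  - by rewrite (leq_fg gal).
  - by have := mi (f a).-1; rewrite -kermx_eq0 => /eqP->; rewrite mul0mx.
  exists u, l; split.
  - by apply/submxP; exists w; apply: eu.
  - rewrite -[b a 1%N]/a -[b a 0%N]/(f a) => a0.
    have -> : D 0%N a.-1 = iota a.-1 by [].
    rewrite mulmxA -pm_hom // -mulmxA el (pm_lab RL) -?colE; last by have := lt_f an; lia.
    apply/colP => i; rewrite !mxE eq; case: eqP => // ei'.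
    by have := lab_mem RL i; rewrite ei' /=; lia.
  - exact: (zero_end 0%N R u iota w hi (ltnW sk) w0 eu).
  rewrite ul (pm_lab RL) -?colE -?rowE; last by have := lt_f an; lia.
  by apply/matrixP => i j; rewrite !ord1 !mxE ep eq !eqxx.
have sk' := bpt_strict_pred sk.
have [u [l [h1 h2 h3 h4]]] := IH sk'.
have eb : b a k.+2 = g (b a k) by rewrite /b bptSS sk'.
have bn i : (b a i <= n)%N := bpt_le_n gal f_le_n lt_f i an'.
have eD i v : D i v *m D i.+1 v = 0.
  by apply/sub_kermxP; case: i => [|i]; [case/andP: (ei v) | case/andP: (ed i v)].
have eD' i v : (kermx (D i.+1 v) <= D i v)%MS.
  by case: i => [|i]; [case/andP: (ei v) | case/andP: (ed i v)].
have hD i : is_hom (D i) by case: i.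
have sk0 : (0 < b a k.+1)%N by apply: leq_trans sk.
have gk : (g (b a k) < b a k.+1)%N by rewrite -eb.
have bk : (b a k.+1 < b a k)%N := sk'.
have w0 : u *m pm (J k) (g (b a k)) (b a k.+1) *m dl k (b a k.+1) = 0.
  by have /submxP[X ->] := h1; rewrite -mulmxA; have -> := eD k (b a k.+1); rewrite mulmx0.
have kl : kermx (dl k (b a k.+1).-1) *m (pm (J k) (b a k.+1).-1 (b a k).-1 *m l) = 0.
  have /submxP[X ->] := eD' k (b a k.+1).-1.
  by rewrite -mulmxA h2 // mulmx0.
(* The class at g b_k = b_(k+2) maps to the next term and is pulled back to g b_(k+1); the
   functional moves from b_k - 1 to b_(k+1) - 1 along the path. *)
have [||u' [l' [eu el ul]]] := injective_step (x := g (b a k.+1)) (y := g (b a k)) (z := b a k.+1)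
    (w := u) (l := pm (J k) (b a k.+1).-1 (b a k).-1 *m l) (iJ k.+1) (hd k) _ _ w0 kl.
- by rewrite (g_mono gal) ?bn ?(ltnW sk') // -eb.
- by rewrite (leq_fg gal).
exists u', l'; split.
- by rewrite eb eu submxMl.
- rewrite eb => b0; have -> : D k.+1 (g (b a k)).-1 = dl k (g (b a k)).-1 by [].
  rewrite mulmxA -pm_hom // -mulmxA el mulmxA pm_trans; [|lia|lia].
  rewrite (pm_f0 S_f) ?mul0mx //; first by case: (iJ k).
  suff : (f (g (b a k)).-1 < b a k)%N by lia.
  by rewrite ltnNge -gal ?bn // -ltnNge prednK.
- have := zero_end k.+1 (J k) u' (dl k); rewrite eb => /(_ u (hd k)); apply=> //; exact: ltnW.
by rewrite ul -mulmxA (mulmxA (pm _ _ _)) pm_trans; [rewrite mulmxA|lia|lia].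
Qed.

Lemma coresolution_auslander_at a k : (a < n)%N -> pd_le n S (J k) k ->
  auslander_at f g a k.
Proof.
move=> an [P [d [e [pP [zP [hdP [he [ee [ede edd]]]]]]]]] sk.
have [u [l [_ _ u0 ul]]] := coresolution_class an sk.
have bn : (b a k <= n)%N := bpt_le_n gal f_le_n lt_f k (ltnW an).
apply: (pd_lower pP zP hdP he ede edd _ _ _ u0 _ ul).
- by rewrite (lt_g gal lt_f) // (leq_ltn_trans _ sk).
- exact: (leq_fg gal).
- exact: submx_full.
move=> s sg; rewrite (pm_f0 S_f) ?mul0mx ?mulmx0 //; first by case: (iJ k).
suff : (f s < b a k)%N by lia.
by rewrite ltnNge -gal // -ltnNge.
Qed.

End Forward.
End Resolutions.

(** * Upper bounds for the projective dimension *)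

Section ProjectiveDimension.
Variables (K : fieldType) (n : nat) (S : nat -> nat -> bool) (f g : nat -> nat).
Hypothesis gal : forall b x, (b <= n)%N -> (g b <= x)%N = (b <= f x)%N.
Hypothesis f_le_n : forall x, (f x <= n)%N.
Hypothesis lt_f : forall x, (x < n)%N -> (x < f x)%N.
Hypothesis S_f : forall i j, (i <= j)%N -> S i j = (f i <= j)%N && (j < n)%N.
Implicit Types M N P : rep K.

Definition zero_rep : rep K := @Rep K (fun _ => 0%N) (fun _ => 0).

Lemma zero_projective M : is_zero_rep M -> projective n S M.
Proof.
move=> z; split.
  by split=> [k _|i l _]; [exact: z | apply: mx_dim0; left; apply: z].
move=> M' N e h _ _ _ _ _; exists (fun k => 0); split=> k; apply: mx_dim0; left; exact: z.
Qed.

Lemma projective_pd_le M : projective n S M -> pd_le n S M 0.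
Proof.
move=> pM; exists (fun j => if j is _.+1 then zero_rep else M).
exists (fun j k => 0), (fun k => 1%:M).
split; first by case=> // j; apply: zero_projective.
split; first by case.
split; first by move=> j k; apply: etrans (mulmx0 _ _) (esym (mul0mx _ _)).
split; first by move=> k; rewrite mul1mx mulmx1.
split; first by move=> k; rewrite /row_full mxrank1.
split=> [k|j k]; apply/andP; split; try exact: sub0mx.
  have -> : kermx (1%:M : 'M[K]_(rdim M k)) = 0.
    by apply/eqP; rewrite kermx_eq0 /row_free mxrank1.
  exact: sub0mx.
by apply/row_subP => i; rewrite [row i _](mx_dim0 _ 0) ?sub0mx //; right.
Qed.

Lemma pd_le_syzygy M P N (i : homf N P) (e : homf P M) m :
  projective n S P -> is_hom i -> is_hom e -> mono i -> epi e -> exact_at i e ->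
  pd_le n S N m -> pd_le n S M m.+1.
Proof.
move=> pP hi he mi ee ie [Q [d [q [pQ [zQ [hd [hq [eq [dq dd]]]]]]]]].
exists (fun j => if j is j'.+1 then Q j' else P).
exists (fun j => match j return homf (Q j) (if j is j'.+1 then Q j' else P) with
                 | 0 => fun k => q k *m i k | j'.+1 => d j' end), e.
split; first by case.
split; first by case=> // j; rewrite ltnS => /zQ.
split; first by case=> [k|j]; [rewrite mulmxA hq -!mulmxA hi | apply: hd].
split=> //; split=> //; split=> [k|[k|j]].
- have /andP[h1 h2] := ie k; apply/andP; split.
    by apply: submx_trans h1; apply: submxMl.
  by apply: submx_trans h2 _; rewrite (eqmxMfull (i k) (eq k)).
- have /andP[h1 h2] := dq k; apply/andP; split.
    by apply/sub_kermxP; move/sub_kermxP: h1; rewrite mulmxA => ->; rewrite mul0mx.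
  apply: submx_trans h2; apply/sub_kermxP; apply: (row_free_inj (mi k)) => /=.
  by rewrite -mulmxA mulmx_ker mul0mx.
exact: dd.
Qed.

Lemma lab_pd_le m (T : finType) M (lab : forall k, 'I_(rdim M k) -> T) (A B : T -> nat) :
  labelled lab A B -> (forall x, (A x < B x)%N -> (B x <= f (A x))%N) ->
  (forall x, pdi f m (A x) (B x)) -> pd_le n S M m.
Proof.
elim: m T M lab A B => [|m IH] T M lab A B ML AB Pd.
  apply: projective_pd_le; apply: (lab_projective gal f_le_n S_f ML) => x Ax.
  apply/eqP; rewrite eqn_leq AB //=; have := Pd x; rewrite /= leqNgt Ax /=.
  by [].
(* Cover [A x, f (A x)) and syzygy [B x, f (A x)) carry the same label x; an empty summand gets an
   empty cover and syzygy. *)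
pose E x := if (A x < B x)%N then f (A x) else B x.
have AE x : (A x < E x)%N -> (A x < B x)%N by rewrite /E; case: ifP => // ->.
have PL := isum_labelled K A E.
have NL := isum_labelled K B E.
apply: (@pd_le_syzygy _ (isum K A E) (isum K B E) (diag_hom (isum_lab B E) (isum_lab A E))
  (diag_hom (isum_lab A E) lab)).
- apply: (lab_projective gal f_le_n S_f PL) => x Ax.
  by rewrite /E AE.
- apply: (diag_is_hom NL PL) => x k; rewrite /E; case: ifP => h; have := @AB x; lia.
- apply: (diag_is_hom PL ML) => x k; rewrite /E; case: ifP => h; have := @AB x; lia.
- apply: (diag_mono NL PL) => x k; rewrite /E; case: ifP => h; have := @AB x; lia.
- apply: (diag_epi PL ML) => x k; rewrite /E; case: ifP => h; have := @AB x; lia.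
- apply: (diag_exact NL PL ML) => x k; rewrite /E; case: ifP => h; have := @AB x; lia.
apply: (IH T _ _ _ _ NL) => x; rewrite /E; case: ifP => h.
- by move=> _; apply: (f_mono gal f_le_n); apply: ltnW.
- by rewrite ltnn.
- by have := Pd x; rewrite /= leqNgt h.
by case: (m) => [|m'] /=; rewrite leqnn.
Qed.

Section Kernel.
Variables (M N : rep K) (e : homf M N).
Hypothesis he : is_hom e.

Definition ker_rep : rep K :=
  @Rep K (fun k => \rank (kermx (e k)))
    (fun k => row_base (kermx (e k)) *m rmap M k *m pinvmx (row_base (kermx (e k.+1)))).

Definition ker_incl : homf ker_rep M := fun k => row_base (kermx (e k)).

Lemma ker_incl_is_hom : is_hom ker_incl.
Proof.
move=> k /=; rewrite mulmxKpV //; rewrite eq_row_base; apply/sub_kermxP.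
rewrite -mulmxA he mulmxA; suff -> : ker_incl k *m e k = 0 by rewrite mul0mx.
by apply/sub_kermxP; rewrite eq_row_base.
Qed.

Lemma ker_incl_mono : mono ker_incl.
Proof. by move=> k; apply: row_base_free. Qed.

Lemma ker_incl_exact : exact_at ker_incl e.
Proof. by move=> k; apply/andP; split; rewrite eq_row_base. Qed.

Lemma ker_is_rep : is_rep n S M -> is_rep n S ker_rep.
Proof.
move=> rM; apply: (pm_is_rep S_f) => [k nk|i j fij].
  by apply/eqP; rewrite -leqn0 (leq_trans (rank_leq_row _)) // (rdim_big rM).
apply: (row_free_inj (ker_incl_mono j)); rewrite [RHS]mul0mx.
by rewrite [LHS](pm_hom _ _ ker_incl_is_hom) (pm_f0 S_f rM) ?mulmx0.
Qed.
End Kernel.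

Lemma row_pm_id M i k (F : nat -> K) : i = k ->
  \row_(a < rdim M i) F a *m pm M i k = \row_(a < rdim M k) F a.
Proof. by move=> <-; rewrite pmxx mulmx1. Qed.

(** Cover M by dim M_k copies of [k, f k) for each k. The cover is injective at the vertices up to
    s, so its kernel is supported from s + 1 on. *)
Lemma supported_pd_le d s M : (n - s <= d)%N -> is_rep n S M ->
  (forall k, (k < s)%N -> rdim M k = 0%N) -> pd_le n S M d.
Proof.
elim: d s M => [|d IH] s M nsd rM Ms.
  apply: projective_pd_le; apply: zero_projective => k.
  by case: (ltnP k s) => [/Ms//|sk]; apply: (rdim_big rM); lia.
pose D := (\sum_(k < n) rdim M k)%N.
pose A (x : 'I_n * 'I_D) : nat := x.1.
pose B (x : 'I_n * 'I_D) : nat := if (x.2 < rdim M x.1)%N then f x.1 else x.1.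
have PL := isum_labelled K A B; set P := isum K A B in PL.
pose v (x : 'I_n * 'I_D) : 'rV[K]_(rdim M (A x)) := \row_j (nat_of_ord j == x.2)%:R.
pose e := hom_out (isum_lab A B) v : homf P M.
have AB x : (A x < B x)%N -> (x.2 < rdim M x.1)%N /\ B x = f (A x).
  by rewrite /A /B; case: ifP => //; rewrite ltnn.
have rP : is_rep n S P by apply: (lab_is_rep gal f_le_n S_f PL) => x /AB[_ ->].
have he : is_hom e.
  by apply: (hom_out_is_hom PL) => x /AB[_ ->]; rewrite (pm_f0 S_f rM) ?mulmx0.
apply: (@pd_le_syzygy _ P (ker_rep e) (@ker_incl _ _ e) e).
- by apply: (lab_projective gal f_le_n S_f PL) => x /AB[].
- exact: ker_incl_is_hom.
- exact: he.
- exact: ker_incl_mono.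
- move=> k; case: (ltnP k n) => kn; last first.
    by apply/eqP; have := rdim_big rM kn; have := rank_leq_col (e k); lia.
  rewrite -sub1mx; apply/row_subP => i.
  have iD : (i < D)%N.
    by rewrite /D (bigD1 (Ordinal kn)) //= ltn_addr.
  have [|p ep] := lab_ex PL (k := k) (x := (Ordinal kn, Ordinal iD)).
    by rewrite /A /B /= ltn_ord leqnn lt_f.
  apply: (eq_row_sub p); rewrite rowK ep.
  apply: etrans (_ : v (Ordinal kn, Ordinal iD) *m 1%:M = _).
    by congr (_ *m _); apply: pmxx.
  by rewrite mulmx1; apply/rowP => j; rewrite !mxE eq_sym.
- exact: ker_incl_exact.
apply: (IH s.+1); [lia|exact: ker_is_rep|move=> k; rewrite ltnS => ks /=].
apply/eqP; rewrite mxrank_eq0 kermx_eq0.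
have xk (p : 'I_(rdim P k)) : (isum_lab A B k p).1 = k :> nat.
  case/andP: (lab_mem PL p); set x := isum_lab _ _ _ p => h1 h2.
  have [x2 _] := AB x (leq_ltn_trans h1 h2).
  case: (ltnP x.1 s) => [/Ms x0|]; first by rewrite x0 in x2.
  by have : (x.1 <= k)%N := h1; lia.
have x2 (p : 'I_(rdim P k)) : ((isum_lab A B k p).2 < rdim M k)%N.
  case/andP: (lab_mem PL p) => h1 h2; have [x2 _] := AB _ (leq_ltn_trans h1 h2).
  by move: x2; rewrite (xk p).
have ek (p : 'I_(rdim P k)) j : e k p j = (nat_of_ord j == (isum_lab A B k p).2)%:R.
  have -> : e k p j = row p (e k) 0 j by rewrite [RHS]mxE.
  rewrite rowK /v (@row_pm_id M _ k (fun a => (a == (isum_lab A B k p).2)%:R)) ?mxE //.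
  exact: xk.
apply/row_freeP; exists (e k)^T; apply/matrixP => p q.
rewrite [LHS]mxE (bigD1 (Ordinal (x2 p))) //= big1 ?addr0 => [|j nj].
  rewrite [X in _ * X]mxE !ek /= eqxx mul1r [RHS]mxE; congr (nat_of_bool _)%:R.
  apply/eqP/eqP => [e2|->//]; apply: (lab_inj PL (k := k)).
  apply/eqP; rewrite -pair_eqE /= /pair_eq /= -(inj_eq val_inj) -[X in _ && X](inj_eq val_inj) /=.
  by rewrite !xk e2 !eqxx.
rewrite ek; case: eqP => [ej|_]; last by rewrite mul0r.
by case/eqP: nj; apply: val_inj.
Qed.

End ProjectiveDimension.

(** * The minimal injective coresolution *)

Section Backward.
Variables (K : fieldType) (n : nat) (S : nat -> nat -> bool) (f g : nat -> nat).
Hypothesis gal : forall b x, (b <= n)%N -> (g b <= x)%N = (b <= f x)%N.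
Hypothesis f_le_n : forall x, (f x <= n)%N.
Hypothesis lt_f : forall x, (x < n)%N -> (x < f x)%N.
Hypothesis S_f : forall i j, (i <= j)%N -> S i j = (f i <= j)%N && (j < n)%N.
Implicit Types M N P : rep K.

(** Moving a nonzero vector of a subrepresentation along arrows until it dies produces a socle
    vector, and the hypothesis on B' - 1 puts the socle of N in the image. *)
Lemma diag_essential (T : eqType) M N (u : forall k, 'I_(rdim M k) -> T)
    (v : forall k, 'I_(rdim N k) -> T) (A B A' B' : T -> nat) :
  labelled u A B -> labelled v A' B' -> is_rep n S N ->
  (forall x, (A' x < B' x)%N -> (A x <= (B' x).-1 < B x)%N) ->
  essential_image (diag_hom u v).
Proof.
move=> ML NL rN H U sU [k Uk].
have [w wU w0] : exists2 w : 'rV_(rdim N k), (w <= U k)%MS & w != 0.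
  by apply/rowV0Pn; rewrite -mxrank_eq0.
have [t [w' [w'0 w'U w'm]]] :
    exists t (w' : 'rV_(rdim N t)), [/\ w' != 0, (w' <= U t)%MS & w' *m rmap N t = 0].
  have [d nd] := ubnPleq (n - k)%N.
  elim: d k {Uk} w wU w0 nd => [|d IH] k w wU w0 nd.
    have nk : (n <= k)%N by lia.
    by case/eqP: w0; apply: mx_dim0; right; apply: rdim_big rN nk.
  case: (eqVneq (w *m rmap N k) 0) => [w1|w1]; first by exists k, w.
  apply: (IH k.+1 _ _ w1); last by lia.
  by apply: submx_trans (sU k); apply: submxMr.
exists t; apply/negP; rewrite mxrank_eq0 => /eqP cap0.
case/eqP: w'0; apply/eqP; rewrite -submx0 -cap0 sub_capmx w'U /=.
rewrite (lab_map NL) in w'm.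
apply: (sub_labmx (lab_inj NL (k:=t)) (lab_inj NL (k:=t.+1)) w'm) => j.
have mj := lab_mem NL j; case: (ltnP t.+1 (B' (v t j))) => h.
  by left; apply: (lab_ex NL); rewrite h; lia.
right; apply: (lab_ex ML); have := H (v t j); lia.
Qed.

Section Construction.
Variables (R : rep K) (lab : forall k, 'I_(rdim R k) -> 'I_n.+1).
Hypothesis RL : labelled lab (fun x => nat_of_ord x) (fun x => f x).
Hypothesis AG : forall k a, (a < n)%N -> auslander_at f g a k.

Let b (x : 'I_n.+1) k := bpt f g x k.
Let A k x := b x k.+2.
Let B k x := b x k.

Lemma exists_min_inj_coresolution :
  exists (J : nat -> rep K) (iota : homf R (J 0%N)) (dl : forall j, homf (J j) (J j.+1)),
    [/\ [/\ (forall j, Defs.injective n S (J j)), is_hom iota & forall j, is_hom (dl j)],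
        [/\ mono iota, exact_at iota (dl 0%N) & forall j, exact_at (dl j) (dl j.+1)],
        essential_image iota, (forall j, essential_image (dl j)) &
        (exists m, is_zero_rep (J m)) /\ forall i, pd_le n S (J i) i].
Proof.
have xn (x : 'I_n.+1) : (x <= n)%N by rewrite -ltnS.
have dec x k : (b x k.+1 <= b x k)%N := bptS_le gal f_le_n lt_f k (xn x).
have bn x k : (b x k <= n)%N := bpt_le_n gal f_le_n lt_f k (xn x).
have bSS x k : (b x k.+1 < b x k)%N -> b x k.+2 = g (b x k).
  by move=> h; rewrite /b bptSS h.
have bSS' x k : (b x k <= b x k.+1)%N -> b x k.+2 = b x k.+1.
  by move=> h; rewrite /b bptSS ltnNge h.
have JL k := isum_labelled K (A k) (B k).
have inj k x : (A k x < B k x)%N -> (B k x <= n)%N /\ A k x = g (B k x).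
  rewrite /A /B => AB; split=> //; apply: bSS; rewrite ltnNge; apply/negP => h.
  by have := bSS' _ _ h; have := dec x k; lia.
have rJ k : is_rep n S (isum K (A k) (B k)).
  by apply: (lab_is_rep gal f_le_n S_f (JL k)) => x /inj[Bn ->]; rewrite (leq_fg gal).
have an (x : 'I_n.+1) k : (b x k.+1 < b x k)%N -> (x < n)%N.
  move/(@bpt_strict_le f g x k 0 (leq0n k)); rewrite /bpt /=.
  by move=> h; apply: leq_trans h (f_le_n _).
exists (fun k => isum K (A k) (B k)), (diag_hom lab (isum_lab (A 0%N) (B 0%N))).
exists (fun k => diag_hom (isum_lab (A k) (B k)) (isum_lab (A k.+1) (B k.+1))).
have b0 x : b x 0%N = f x by [].
have b1 x : b x 1%N = x by [].
split.
- split=> [k||k].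
  + exact: (lab_injective gal f_le_n S_f (JL k) (@inj k)).
  + apply: (diag_is_hom RL (JL 0%N)) => x k; rewrite /A /B; move: (b0 x) (b1 x).
    by have := dec x 1%N; lia.
  apply: (diag_is_hom (JL k) (JL k.+1)) => x t; rewrite /A /B.
  by have := dec x k.+2; have := dec x k.+1; have := dec x k; lia.
- split=> [||k].
  + apply: (diag_mono RL (JL 0%N)) => x k; rewrite /A /B; move: (b0 x) (b1 x).
    by have := dec x 1%N; lia.
  + apply: (diag_exact RL (JL 0%N) (JL 1%N)) => x k; rewrite /A /B; move: (b0 x) (b1 x).
    by have := dec x 2%N; have := dec x 1%N; have := dec x 0%N; lia.
  apply: (diag_exact (JL k) (JL k.+1) (JL k.+2)) => x t; rewrite /A /B.
  by have := dec x k.+3; have := dec x k.+2; have := dec x k.+1; have := dec x k; lia.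
- apply: (diag_essential RL (JL 0%N) (rJ 0%N)) => x /=; rewrite /A /B; move: (b0 x) (b1 x).
  case: (ltnP (b x 1%N) (b x 0%N)) => h; first by lia.
  by rewrite bSS' //; have := dec x 0%N; lia.
- move=> k; apply: (diag_essential (JL k) (JL k.+1) (rJ k.+1)) => x /=; rewrite /A /B.
  have := dec x k; case: (ltnP (b x k.+2) (b x k.+1)) => h; first by lia.
  by rewrite bSS' //; lia.
split.
  (* By [bpt_bound] a nonzero k-th cosyzygy forces b_k + k <= n, so degree n + 1 is empty. *)
  exists n.+1 => k; apply/eqP; rewrite -leqn0 leqNgt; apply/negP => h.
  have := lab_mem (JL n.+1) (Ordinal h); set x := isum_lab _ _ _ _ => hx.
  have {}hx : (A n.+1 x <= k < B n.+1 x)%N := hx; rewrite /A /B in hx.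
  case: (ltnP (b x n.+2) (b x n.+1)) => h1.
    by have := bpt_bound f_le_n (an _ _ h1) h1; lia.
  by have := bSS' _ _ h1; lia.
move=> k; apply: (lab_pd_le gal f_le_n S_f (JL k)) => [x /inj[Bn ->]|x].
  by rewrite (leq_fg gal).
rewrite /A /B; case: (ltnP (b x k.+1) (b x k)) => h.
  by rewrite bSS //; exact: AG (an _ _ h) h.
by case: k h => [|k] h /=; rewrite bSS' // h.
Qed.

End Construction.
End Backward.

(** * The Galois connection of an admissible ideal *)

Section FromIdeal.
Variables (n : nat) (S : nat -> nat -> bool).
Hypothesis adm : admissible_ideal n S.

Lemma sum_bool_le m (p : nat -> bool) : (\sum_(j < m) p j <= m)%N.
Proof.
apply: leq_trans (_ : \sum_(j < m) 1 <= m)%N; last by rewrite sum1_card card_ord.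
by apply: leq_sum => j _; apply: leq_b1.
Qed.

(** An initial segment is determined by its cardinality; this turns the counts [aS] and [proj_end]
    into thresholds. *)
Lemma count_initial (p : nat -> bool) m :
  (forall i j, (j <= i < m)%N -> p i -> p j) ->
  forall i, (i < m)%N -> p i = (i < \sum_(j < m) p j)%N.
Proof.
elim: m => // m IH H i; rewrite ltnS big_ord_recr /=.
have le_m := sum_bool_le m p.
case: (boolP (p m)) => pm im.
  have -> : (\sum_(j < m) p j = m)%N.
    rewrite -[RHS](card_ord m) -sum1_card; apply: eq_bigr => j _.
    by rewrite (H m j) // ltnS leqnn ltnW.
  by rewrite (H m i) ?im ?leqnn //; lia.
move: im; rewrite addn0 leq_eqVlt => /orP[/eqP->|im].
  by rewrite (negPf pm) ltnNge le_m.
by apply: IH => // i' j' /andP[h1 h2]; apply: H; lia.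
Qed.

(** The injective with socle at vertex k ends at the gap k + 1 and starts at [aS S k], the source of
    the longest nonzero path into k. *)
Definition inj_start (b : nat) : nat := if b is k.+1 then aS S k else 0%N.
(** Since [aS S] is monotone below n, the vertices counted form an initial segment, and the count is
    its end gap. *)
Definition proj_end (x : nat) : nat := (\sum_(k < n) (aS S k <= x))%N.

Lemma aS_le k : (aS S k <= k)%N.
Proof. exact: (sum_bool_le k (S^~ k)). Qed.

Lemma S_aS i k : (k < n)%N -> S i k = (i < aS S k)%N.
Proof.
case: adm => a1 [a2 a3] kn; case: (ltnP i k) => ik.
  rewrite /aS; apply: (@count_initial (fun i => S i k) k) => // i' j' /andP[h _] s; apply: (a3 _ _ _ _ s h (leqnn _) kn).
have -> : S i k = false by apply/negP => /a1; lia.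
by have := aS_le k; lia.
Qed.

Lemma aS_mono j k : (j <= k < n)%N -> (aS S j <= aS S k)%N.
Proof.
case/andP=> jk kn; case e : (aS S j) => [|c] //.
have : S c j by rewrite S_aS ?e //; lia.
by case: adm => _ [_ a3] s; rewrite -S_aS //; apply: (a3 _ _ _ _ s (leqnn _) jk kn).
Qed.

Lemma inj_start_gal b x : (b <= n)%N -> (inj_start b <= x)%N = (b <= proj_end x)%N.
Proof.
case: b => [|k] kn; first by rewrite !leq0n.
apply: (@count_initial (fun k => (aS S k <= x)%N) n) => // i j ij; apply: leq_trans.
exact: aS_mono.
Qed.

Lemma proj_end_le_n x : (proj_end x <= n)%N.
Proof. exact: (sum_bool_le n (fun k => aS S k <= x)%N). Qed.

Lemma lt_proj_end x : (x < n)%N -> (x < proj_end x)%N.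
Proof. by move=> xn; rewrite -(inj_start_gal (b := x.+1)) // aS_le. Qed.

Lemma S_proj_end i j : (i <= j)%N -> S i j = (proj_end i <= j)%N && (j < n)%N.
Proof.
move=> ij; case: (ltnP j n) => jn; rewrite ?andbT ?andbF.
  by rewrite S_aS // ltnNge (inj_start_gal (b := j.+1)) // leqNgt negbK.
by case: adm => _ [a2 _]; apply/negP => /a2; lia.
Qed.

Section RegularRep.
Variable K : fieldType.

(** A path belongs to the summand e_x A with x its source. *)
Definition reg_lab k (j : 'I_(rdim (regular_rep K n S) k)) : 'I_n.+1 := inord (aS S k + j).

Lemma reg_lab_val k (j : 'I_(rdim (regular_rep K n S) k)) :
  [/\ reg_lab j = (aS S k + j)%N :> nat, (k < n)%N & (aS S k + j <= k)%N].
Proof.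
have jk : (j < if k < n then k.+1 - aS S k else 0)%N := ltn_ord j.
case: ifP jk => // kn jk.
have h : (aS S k + j <= k)%N by lia.
by split=> //; rewrite inordK //; lia.
Qed.

Lemma reg_labelled :
  labelled (@reg_lab) (fun x => nat_of_ord x) (fun x => proj_end x).
Proof.
split=> [k i j e|k i|k x|k].
- have [ei _ _] := reg_lab_val i; have [ej _ _] := reg_lab_val j.
  by apply/ord_inj/(@addnI (aS S k)); rewrite -ei -ej e.
- have [-> kn ik] := reg_lab_val i; rewrite ik /=.
  by rewrite -(inj_start_gal (b := k.+1)) // leq_addr.
- case/andP=> xk kf; have kn := leq_trans kf (proj_end_le_n x).
  have ax : (aS S k <= x)%N by have := kf; rewrite -(inj_start_gal (b := k.+1)).
  have h : (x - aS S k < rdim (regular_rep K n S) k)%N.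
    rewrite /= /regdim kn; lia.
  exists (Ordinal h); apply: ord_inj.
  by have [-> _ _] := reg_lab_val (Ordinal h); rewrite /= subnKC.
apply/matrixP => i j; rewrite !mxE -(inj_eq (@ord_inj _)).
have [ei _ _] := reg_lab_val i; have [ej _ _] := reg_lab_val j.
by rewrite ei ej.
Qed.
End RegularRep.

Notation f := proj_end.
Notation g := inj_start.

Lemma AuslanderRegularP (K : fieldType) :
  AuslanderRegular K n S <-> forall k a, (a < n)%N -> auslander_at f g a k.
Proof.
have gal := inj_start_gal; have fn := proj_end_le_n.
have lt_f := lt_proj_end; have S_f := S_proj_end.
split=> [[[J [iota [dl [[iJ [hi [hd [mi [ei [ed _]]]]]] [_ pd]]]]] _] k a an|AG].
  exact: (coresolution_auslander_at gal fn lt_f S_f (reg_labelled K) iJ hi hd mi ei ed an).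
split; last first.
  exists n => M rM; apply: (supported_pd_le gal fn lt_f S_f (s := 0)) => //.
  by rewrite subn0.
have [J [iota [dl [[h1 h2 h3] [h4 h5 h6] h7 h8 [h9 h10]]]]] :=
  exists_min_inj_coresolution gal fn lt_f S_f (reg_labelled K) AG.
by exists J, iota, dl; split.
Qed.

End FromIdeal.

(** * The Coxeter matrix *)

Lemma bruhat_leading n (C : 'M[rat]_n) (c : 'I_n -> 'I_n) :
  C \in unitmx -> (forall a, C a (c a) != 0) ->
  (forall a (j : 'I_n), (j < c a)%N -> C a j = 0) ->
  (exists U1 P U2, bruhat_decomposition C U1 P U2 /\ U1 = 1%:M) <-> injective c.
Proof.
move=> uC c1 c0; split=> [[U1 [P [U2 [[_ /is_perm_mxP[s ->] [tU uU] CE] e1]]]]|ci].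
  have CU a j : C a j = U2 (s a) j by rewrite CE e1 mul1mx -row_permE !mxE.
  have Ud i : U2 i i != 0.
    move: uU; rewrite unitmxE -det_tr det_trig; last first.
      by apply/is_trig_mxP => i' j' ij; rewrite mxE tU.
    by rewrite unitfE => /prodf_neq0/(_ i isT); rewrite mxE.
  move=> a b cab; apply: (@perm_inj _ s); apply: ord_inj.
  have cs x : c x = s x :> nat.
    apply/eqP; rewrite eqn_leq; apply/andP; split; rewrite leqNgt; apply/negP => h.
      by have := Ud (s x); rewrite -CU c0 ?eqxx.
    by have := c1 x; rewrite CU tU ?eqxx.
  by rewrite -!cs cab.
pose s := perm ci.
exists 1%:M, (perm_mx s), (row_perm s^-1 C); split=> //; split.
- split; last exact: unitmx1.
  by move=> i j ji; rewrite mxE; case: eqP => // e; rewrite e ltnn in ji.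
- by apply/is_perm_mxP; exists s.
- split; last by rewrite row_permE unitmx_mul unitmx_perm.
  move=> i j ji; rewrite mxE; apply: c0; suff -> : c (s^-1%g i) = i by [].
  by rewrite -[LHS](permE ci) permKV.
rewrite mul1mx row_permE mulmxA -perm_mxM.
by rewrite mulgV perm_mx1 mul1mx.
Qed.

Section Coxeter.
Variables (n : nat) (S : nat -> nat -> bool).
Hypothesis adm : admissible_ideal n S.
Local Notation f := (proj_end n S).
Local Notation g := (inj_start S).
Local Notation b := (bpt f g).

Lemma cartan_unit : cartan n S \in unitmx.
Proof.
rewrite unitmxE det_trig; last first.
  by apply/is_trig_mxP => i j ij; rewrite mxE leqNgt ij.
rewrite big1 ?unitr1 // => i _; rewrite mxE leqnn /=.
by case: (boolP (S i i)) => // /(proj1 adm); lia.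
Qed.

Let gal := inj_start_gal adm.
Let fn := proj_end_le_n n S.
Let lt_f := lt_proj_end adm.

(** Row i is the dimension vector of the injective [g (i+1), i+1). *)
Lemma cartanE (i j : 'I_n) : cartan n S i j = (g i.+1 <= j < i.+1)%N%:R.
Proof.
rewrite mxE; congr (nat_of_bool _)%:R; case: (leqP j i) => ji /=; last by lia.
by rewrite (S_aS adm) // -leqNgt; lia.
Qed.

(* The alternating sum of the classes of the terms of the minimal injective
   coresolution of each indecomposable projective. *)
Definition coresolution_mx : 'M[rat]_n :=
  \matrix_(a, j) \sum_(k < n) (-1) ^+ k * ((b a k.+1 < b a k)%N && (b a k == j.+1))%:R.

Lemma bpt_strict_lt_n (a k : nat) : (a < n)%N -> (b a k.+1 < b a k)%N -> (k < n)%N.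
Proof. by move=> an sk; have := bpt_bound fn an sk; lia. Qed.

(** The dimension vector of [a, f a) is the alternating sum of those of its coresolution. With [c k]
    the indicator of the k-th cosyzygy, the k-th term contributes c k + c (k+1), and the sum
    telescopes. *)
Lemma coresolution_mxE : coresolution_mx *m cartan n S = (cartan n S)^T.
Proof.
apply/matrixP => a t; have an := ltn_ord a; have an' := ltnW an.
pose c k := ((b a k.+1 <= t < b a k)%N%:R : rat).
have dec k : (b a k.+1 <= b a k)%N := bptS_le gal fn lt_f k an'.
rewrite mxE; under eq_bigr => j _ do rewrite mxE mulr_suml.
rewrite exchange_big /=.
have E (k : 'I_n) : \sum_(j < n) (-1) ^+ k * ((b a k.+1 < b a k)%N && (b a k == j.+1))%:R *
    cartan n S j t = (-1) ^+ k * c k - (-1) ^+ k.+1 * c k.+1.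
  have -> : (-1) ^+ k * c k - (-1) ^+ k.+1 * c k.+1 = (-1) ^+ k * (c k + c k.+1) :> rat.
    by rewrite exprS mulN1r mulNr opprK -mulrDr.
  have -> : c k + c k.+1 = (b a k.+2 <= t < b a k)%N%:R.
    rewrite /c -natrD; congr _%:R; have := dec k; have := dec k.+1; lia.
  rewrite bptSS; case: (ltnP (b a k.+1) (b a k)) => h; last first.
    rewrite big1 => [|j _]; last by rewrite mulr0 mul0r.
    by rewrite (_ : (_ <= _ < _)%N = false) ?mulr0 //; lia.
  have bk0 : (0 < b a k)%N by apply: leq_ltn_trans h.
  have bn : ((b a k).-1 < n)%N by rewrite prednK // (bpt_le_n gal fn lt_f).
  rewrite (bigD1 (Ordinal bn)) //= big1 ?addr0 => [|j nj].
    have e : (Ordinal bn).+1 = b a k by rewrite /= prednK.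
    by rewrite prednK // eqxx mulr1 cartanE e.
  rewrite (_ : b a k == j.+1 = false) ?mulr0 ?mul0r //.
  by apply: contraNF nj => /eqP e; apply/eqP/ord_inj; rewrite /= e.
rewrite (eq_bigr _ (fun k _ => E k)) -(big_mkord xpredT
  (fun k => (-1) ^+ k * c k - (-1) ^+ k.+1 * c k.+1)).
rewrite (telescope_sumr_eq (fun k => - ((-1) ^+ k * c k))) // => [|k _]; last first.
  by rewrite opprK addrC.
have -> : c n = 0.
  rewrite /c (_ : (_ <= _ < _)%N = false) //; apply/negbTE/negP => h.
  by have := @bpt_strict_lt_n a n an; lia.
rewrite mulr0 oppr0 add0r opprK mul1r /c !mxE; congr (nat_of_bool _)%:R.
rewrite -[b a 1%N]/(nat_of_ord a) -[b a 0%N]/(f a).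
case: (leqP a t) => //= at'.
by rewrite (S_proj_end adm) // ltn_ord andbT -ltnNge.
Qed.

Lemma coxeterE : coxeter n S = - coresolution_mx.
Proof. by rewrite /coxeter -coresolution_mxE mulmxK // cartan_unit. Qed.

Lemma coxeter_unit : coxeter n S \in unitmx.
Proof.
rewrite /coxeter -scaleN1r unitmxZ ?unitrN1 // unitmx_mul unitmx_tr unitmx_inv.
by rewrite cartan_unit.
Qed.

Lemma bpt_leq (a i k : nat) : (a <= n)%N -> (i <= k)%N -> (b a k <= b a i)%N.
Proof.
move=> an; elim: k => [|k IH]; first by rewrite leqn0 => /eqP->.
rewrite leq_eqVlt => /orP[/eqP->//|ik].
by apply: leq_trans (IH ik); apply: (bptS_le gal fn lt_f).
Qed.

(** The b_k strictly decrease up to degree d, so b_d is the smallest of them and occurs once, with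
    coefficient 1 or -1. *)
Lemma coxeter_leading (a : 'I_n) d (c : 'I_n) :
  last_term f g a d -> b a d = c.+1 ->
  coxeter n S a c != 0 /\ forall j : 'I_n, (j < c)%N -> coxeter n S a j = 0.
Proof.
move=> /andP[sd ld] bd; have an := ltn_ord a.
have dn := bpt_strict_lt_n an sd.
have strict_gt i k : (i < k)%N -> (b a k.+1 < b a k)%N -> (b a k < b a i)%N.
  move=> ik sk; apply: leq_ltn_trans (bpt_leq (ltnW an) ik) _.
  by apply: bpt_strict_le sk; apply: ltnW.
rewrite coxeterE; split=> [|j jc]; rewrite !mxE oppr_eq0 || rewrite !mxE.
  rewrite (bigD1 (Ordinal dn)) //= big1 => [|k kd].
    by rewrite sd bd eqxx mulr1 addr0 signr_eq0.
  case: (ltnP (b a k.+1) (b a k)) => sk /=; last by rewrite mulr0.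
  have -> : (b a k == c.+1) = false; last by rewrite mulr0.
  have kd' : k != d :> nat by apply: contra kd => /eqP e; apply/eqP/ord_inj.
  apply/eqP; rewrite -bd; case: (ltngtP k d) kd' => // h _.
    by have := strict_gt k d h sd; lia.
  by have := strict_gt d k h sk; lia.
rewrite big1 ?oppr0 // => k _; case: (ltnP (b a k.+1) (b a k)) => sk /=; last by rewrite mulr0.
have -> : (b a k == j.+1) = false; last by rewrite mulr0.
apply/eqP => bk; case: (ltnP d k) => dk.
  by have := bpt_strict_le dk sk; lia.
by have := bpt_leq (ltnW an) dk; lia.
Qed.

End Coxeter.

Theorem mainTheorem5 (K : fieldType) (n : nat) (S : nat -> nat -> bool) :
  admissible_ideal n S ->
  (AuslanderRegular K n S <->
   exists U1 P U2 : 'M[rat]_n,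
     bruhat_decomposition (coxeter n S) U1 P U2 /\ U1 = 1%:M).
Proof.
move=> adm; have gal := inj_start_gal adm; have fn := proj_end_le_n n S.
have lt_f := lt_proj_end adm.
have /fin_all_exists[c cP] : forall a : 'I_n, exists c : 'I_n, exists d,
    last_term (proj_end n S) (inj_start S) a d /\
    bpt (proj_end n S) (inj_start S) a d = c.+1.
  move=> a; have [d ld] := exists_last (inj_start S) fn lt_f (ltn_ord a).
  have /andP[sd _] := ld; have b0 := leq_ltn_trans (leq0n _) sd.
  have bn := bpt_le_n gal fn lt_f d (ltnW (ltn_ord a)).
  have cn : ((bpt (proj_end n S) (inj_start S) a d).-1 < n)%N by rewrite prednK.
  by exists (Ordinal cn), d; rewrite /= prednK.
rewrite (bruhat_leading (c := c) (coxeter_unit adm)); first last.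
- by move=> a; have [d [ld bd]] := cP a; case: (coxeter_leading adm ld bd).
- by move=> a; have [d [ld bd]] := cP a; case: (coxeter_leading adm ld bd).
rewrite AuslanderRegularP //; split=> [AG a a' cc|ci].
  have [d [ld bd]] := cP a; have [d' [ld' bd']] := cP a'.
  apply: ord_inj; apply: (last_inj gal fn lt_f _ _ ld ld') => //.
  - by move=> i; apply: AG.
  - by move=> i; apply: AG.
  by rewrite bd bd' cc.
move=> k a an; apply: (surj_auslander gal fn lt_f _ an) => e /andP[e0 en].
have en' : (e.-1 < n)%N by rewrite prednK.
(* An injective self-map of a finite set is onto, so [invF] supplies the preimage of e - 1. *)
have [d [ld bd]] := cP (invF ci (Ordinal en')).
exists (invF ci (Ordinal en')), d; split=> //.
by rewrite bd f_invF /= prednK.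
Qed.
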